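(* A four-dimensional solvable subalgebra of $\mathfrak{sp}(4,\mathbb{C})$ containing a nonzero non-regular semisimple element but not a Cartan subalgebra is equivalent to one of the following: $$\langle T_{0,1},\mathfrak{n}_{\mathfrak{p}}\rangle\sim\langle T_{1,0},\mathfrak{n}_{\mathfrak{p}}\rangle,$$ $$\langle T_{0,1},X_{\beta},X_{\alpha+\beta},X_{\alpha+2\beta}\rangle,$$ $$\langle T_{1,0},X_{\beta},X_{\alpha+\beta},X_{\alpha+2\beta}\rangle,$$ $$\langle T_{1,1},\mathfrak{n}_{\mathfrak{p}}\rangle,$$ $$\langle T_{1,-1},\mathfrak{n}_{\mathfrak{p}}\rangle,$$ $$\langle T_{1,1},X_{\beta},X_{\alpha+\beta},X_{\alpha+2\beta}\rangle\sim\langle T_{1,-1},X_{\beta},X_{\alpha+\beta},X_{\alpha+2\beta}\rangle .$$ These algebras are all pairwise inequivalent (apart from the equivalences $\sim$ noted).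
   Context: Let $J=\begin{pmatrix}0&0&1&0\\0&0&0&1\\-1&0&0&0\\0&-1&0&0\end{pmatrix}$. $\mathfrak{sp}(4,\mathbb{C})$ is the Lie algebra of $4\times4$ complex matrices $X$ with $JX^tJ=X$, and $Sp(4,\mathbb{C})=\{g\in GL(4,\mathbb{C}) : gJg^t=J\}$, acting on $\mathfrak{sp}(4,\mathbb{C})$ by conjugation $X\mapsto gXg^{-1}$. For $a,b\in\mathbb{C}$, $T_{a,b}=\mathrm{diag}(a,b,-a,-b)$. A Cartan subalgebra of $\mathfrak{sp}(4,\mathbb{C})$ is a two-dimensional subalgebra of commuting semisimple (diagonalizable) elements. A semisimple element of $\mathfrak{sp}(4,\mathbb{C})$ is regular if it has four distinct eigenvalues, and non-regular otherwise. With $E_{ij}$ the matrix units, $X_\alpha=E_{24}$, $X_\beta=E_{12}-E_{43}$, $X_{\alpha+\beta}=E_{14}+E_{23}$, $X_{\alpha+2\beta}=E_{13}$. $\langle\,\cdot\,\rangle$ denotes the complex linear span of the listed elements and subspaces, and $\mathfrak{n}_{\mathfrak{p}}=\langle X_\alpha,X_{\alpha+\beta},X_{\alpha+2\beta}\rangle$. Two subalgebras are equivalent, written $\sim$, if some $g\in Sp(4,\mathbb{C})$ conjugates one onto the other. *)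

(* Defs.v *)
From HB Require Import structures.
From mathcomp Require Import all_boot all_order all_algebra.
From mathcomp Require Export reals complex.

Set Implicit Arguments.
Unset Strict Implicit.
Unset Printing Implicit Defensive.

Import GRing.Theory.
Local Open Scope ring_scope.

Section SymplecticLieAlgebra.
Variable F : fieldType.
Implicit Types (a b : F) (X Y g : 'M[F]_4) (s t h : {vspace 'M[F]_4}).

(* The block form has type 'M_(2 + 2), which is convertible to 'M_4. *)
Definition J : 'M[F]_4 :=
  block_mx (0 : 'M[F]_2) (1%:M : 'M[F]_2) (- 1%:M : 'M[F]_2) (0 : 'M[F]_2).

Definition sp4 : {pred 'M[F]_4} := [pred X | J *m X^T *m J == X].

Definition Sp4 : {pred 'M[F]_4} :=
  [pred g | (g \in unitmx) && (g *m J *m g^T == J)].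

Definition lie X Y : 'M[F]_4 := X *m Y - Y *m X.

Definition lie_subalgebra s : Prop :=
  {subset s <= sp4} /\ {in s &, forall X Y, lie X Y \in s}.

(* By bilinearity, the brackets of basis elements span all of [s, s]. *)
Definition lie_derived s : {vspace 'M[F]_4} :=
  <<[seq lie X Y | X <- vbasis s, Y <- vbasis s]>>%VS.

Definition lie_solvable s : Prop := exists n, iter n lie_derived s = 0%VS.

Definition semisimple X : Prop := diagonalizable X.

Definition regular X : Prop :=
  semisimple X /\
  exists e : seq F, [/\ size e = 4%N, uniq e & all (eigenvalue X) e].

Definition cartan_subalgebra h : Prop :=
  [/\ lie_subalgebra h, \dim h = 2%N,
      {in h &, forall X Y, lie X Y = 0}
    & {in h, forall X, semisimple X}].

(* X |-> g X g^-1; linear in X for every matrix g. *)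
Definition conj_by g : 'End('M[F]_4) :=
  linfun (mulmxr (invmx g) \o mulmx g).

Definition sp4_equiv s t : Prop :=
  exists2 g, g \in Sp4 & (conj_by g @: s)%VS = t.

(* Matrix units with row and column numbers running from 1 to 4. *)
Definition E (i j : nat) : 'M[F]_4 := delta_mx (inord i.-1) (inord j.-1).

Definition T a b : 'M[F]_4 := diag_mx (\row_(j < 4) [:: a; b; - a; - b]`_j).

Definition X_alpha : 'M[F]_4 := E 2 4.
Definition X_beta : 'M[F]_4 := E 1 2 - E 4 3.
Definition X_alpha_beta : 'M[F]_4 := E 1 4 + E 2 3.
Definition X_alpha_2beta : 'M[F]_4 := E 1 3.

Definition n_p : {vspace 'M[F]_4} :=
  <<[:: X_alpha; X_alpha_beta; X_alpha_2beta]>>%VS.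

Definition T_n_p a b : {vspace 'M[F]_4} := (<[T a b]> + n_p)%VS.

Definition T_beta a b : {vspace 'M[F]_4} :=
  <<[:: T a b; X_beta; X_alpha_beta; X_alpha_2beta]>>%VS.

(* One representative of each equivalence class of the classification. *)
Definition normal_forms : seq {vspace 'M[F]_4} :=
  [:: T_n_p 0 1; T_beta 0 1; T_beta 1 0; T_n_p 1 1; T_n_p 1 (- 1); T_beta 1 1].

End SymplecticLieAlgebra.

Arguments sp4 {F}.
Arguments Sp4 {F}.

(* Main.v *)
Require Import Defs.
From mathcomp Require Import all_boot all_order all_algebra.
From mathcomp Require Import reals complex.
From mathcomp Require Import boolp ring.

Set Implicit Arguments.
Unset Strict Implicit.
Unset Printing Implicit Defensive.

Import Order.TTheory GRing.Theory Num.Theory.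
Local Open Scope ring_scope.

(* A symplectic basis of eigenvectors conjugates the non-regular semisimple
   element to T a b, and Weyl group elements and scaling reduce to S = T 1 0 or
   S = T 1 1.  Then s is graded by the eigenvalues of ad S.  The centralizer of S
   is the direct sum of the line through S and a copy of sl2; since s contains no
   Cartan subalgebra, s meets that sl2 in nilpotent elements only, hence in 0 or,
   after conjugation, in the line of X_alpha (S = T 1 0) or X_beta (S = T 1 1).
   In each of these cases, bracket relations between the graded pieces, dim s = 4
   and the absence of an sl2-triple in the solvable algebra s leave the listed
   algebras up to a Weyl group element.
   The normal forms are separated by three conjugation invariants: whether
   X^2 = 1 has a solution, whether the center is nonzero, and whether there are
   non-commuting X, Y with X^2 = Y^2 = 0. *)

(** * Coordinates on sp(4) *)

Section Coordinates.
Variable F : fieldType.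
Implicit Types (a b c d x y z u v w k : F) (X Y Z g h : 'M[F]_4).

(** The obstacle is that positive and negative degrees of the grading may both occur in s. They are
    played off against each other: a bracket of opposite degrees lands in degree 0, where almost
    nothing is allowed, and a bracket with the chosen nilpotent element tends to produce a fifth
    independent element. Once one side is excluded, the Weyl element reversing the grading reduces
    to the positive side, and equality with a normal form follows from an inclusion and a dimension
    count. The branches end as follows. For S = T 1 0, degree 0 equal to the line of S gives
    [T_beta 1 0], and X_alpha gives [T_n_p 0 1] or [T_beta 0 1]. For S = T 1 1, degree 0 equal to
    the line of S gives [T_n_p 1 1], and X_beta gives [T_beta 1 1] or [T_n_p 1 (- 1)]. *)

Definition mx4 (l : seq (seq F)) : 'M[F]_4 :=
  \matrix_(i, j) (nth [::] l i)`_j.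

(* The block matrix [[A, B], [C, - A^T]] with A = [[a, b], [c, d]] and symmetric
   B = [[x, y], [y, z]], C = [[u, v], [v, w]].  The coordinates b, x, y, z belong to
   the roots beta, alpha + 2 beta, alpha + beta, alpha, and c, u, v, w to their
   opposites. *)
Definition spm a b c d x y z u v w : 'M[F]_4 :=
  mx4 [:: [:: a; b; x; y]; [:: c; d; y; z];
          [:: u; v; - a; - c]; [:: v; w; - b; - d]].

Lemma ord4P (P : 'I_4 -> Prop) :
  P (inord 0) -> P (inord 1) -> P (inord 2) -> P (inord 3) -> forall i, P i.
Proof.
move=> P0 P1 P2 P3 i; rewrite -(inord_val i).
by case: i => -[|[|[|[|]]]].
Qed.

(** Indices are natural numbers, so that a sixteen-way case split leaves literal positions at which
    [nth] computes. *)
Lemma eq_mx4 X Y :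
  (forall i j, (i < 4)%N -> (j < 4)%N -> X (inord i) (inord j) = Y (inord i) (inord j)) -> X = Y.
Proof. by move=> eqXY; apply/matrixP => i j; rewrite -(inord_val i) -(inord_val j) eqXY. Qed.

Lemma eq_inord4 i j : (i < 4)%N -> (j < 4)%N ->
  (inord i == inord j :> 'I_4) = (i == j).
Proof. by move=> lti ltj; rewrite -val_eqE /= !inordK. Qed.

Lemma mx4E l i j : (i < 4)%N -> (j < 4)%N ->
  mx4 l (inord i) (inord j) = (nth [::] l i)`_j.
Proof. by move=> lti ltj; rewrite mxE !inordK. Qed.

Lemma sum_ord4 (V : nmodType) (f : 'I_4 -> V) :
  \sum_i f i = f (inord 0) + f (inord 1) + f (inord 2) + f (inord 3).
Proof.
rewrite !big_ord_recl big_ord0 addr0 !addrA.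
by congr (_ + _ + _ + _); congr f; apply: val_inj; rewrite /= inordK.
Qed.

Lemma mulmx4 X Y i j : (X *m Y) i j =
  X i (inord 0) * Y (inord 0) j + X i (inord 1) * Y (inord 1) j +
  X i (inord 2) * Y (inord 2) j + X i (inord 3) * Y (inord 3) j.
Proof. by rewrite mxE sum_ord4. Qed.

Lemma mx4_eta X : X = mx4 [seq [seq X (inord i) (inord j) | j <- iota 0 4] | i <- iota 0 4].
Proof.
by apply: eq_mx4; move=> [|[|[|[|i]]]] [|[|[|[|j]]]] // _ _; rewrite mx4E.
Qed.

End Coordinates.

Ltac mx4_entries :=
  apply: eq_mx4; move=> [|[|[|[|?]]]] [|[|[|[|?]]]] // _ _.
Ltac mx4_ring := mx4_entries; rewrite !(mulmx4, mx4E, mxE) ?inordK ?eq_inord4 //=; ring.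

Section LieCoordinates.
Variable F : fieldType.
Implicit Types (a b c d x y z u v w k : F) (X Y Z g h : 'M[F]_4).

Lemma spmD a b c d x y z u v w a' b' c' d' x' y' z' u' v' w' :
  spm a b c d x y z u v w + spm a' b' c' d' x' y' z' u' v' w' =
  spm (a + a') (b + b') (c + c') (d + d') (x + x') (y + y') (z + z') (u + u') (v + v') (w + w').
Proof. mx4_ring. Qed.

Lemma spmZ k a b c d x y z u v w :
  k *: spm a b c d x y z u v w =
  spm (k * a) (k * b) (k * c) (k * d) (k * x) (k * y) (k * z) (k * u) (k * v) (k * w).
Proof. mx4_ring. Qed.

Lemma lie_spm a b c d x y z u v w a' b' c' d' x' y' z' u' v' w' :
  lie (spm a b c d x y z u v w) (spm a' b' c' d' x' y' z' u' v' w') =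
  spm (b * c' - b' * c + x * u' + y * v' - x' * u - y' * v)
      (a * b' + b * d' - a' * b - b' * d + x * v' + y * w' - x' * v - y' * w)
      (c * a' + d * c' - c' * a - d' * c + y * u' + z * v' - y' * u - z' * v)
      (c * b' - c' * b + y * v' + z * w' - y' * v - z' * w)
      ((a * x' + b * y' - a' * x - b' * y) *+ 2)
      (a * y' + b * z' + c * x' + d * y' - a' * y - b' * z - c' * x - d' * y)
      ((c * y' + d * z' - c' * y - d' * z) *+ 2)
      ((a' * u + c' * v - a * u' - c * v') *+ 2)
      (a' * v + c' * w + b' * u + d' * v - a * v' - c * w' - b * u' - d * v')
      ((b' * v + d' * w - b * v' - d * w') *+ 2).
Proof. rewrite /lie; mx4_ring. Qed.

Lemma JE : J F = mx4 [:: [:: 0; 0; 1; 0]; [:: 0; 0; 0; 1]; [:: -1; 0; 0; 0]; [:: 0; -1; 0; 0]].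
Proof.
apply/matrixP => i j; rewrite [RHS]mxE /J.
case: (@split_ordP 2 2 i) => k ->; case: (@split_ordP 2 2 j) => l ->;
  rewrite ?(@block_mxEul F 2 2 2 2, @block_mxEur F 2 2 2 2,
    @block_mxEdl F 2 2 2 2, @block_mxEdr F 2 2 2 2) !mxE -?val_eqE;
  by case: k => -[|[|?]] // ?; case: l => -[|[|?]] // ?; rewrite /= ?oppr0.
Qed.

Lemma TE a b : T a b = spm a 0 0 b 0 0 0 0 0 0.
Proof. by mx4_entries; rewrite mx4E // /T !mxE inordK //= eq_inord4 //= ?oppr0. Qed.

Lemma X_alphaE : X_alpha F = spm 0 0 0 0 0 0 1 0 0 0.
Proof.
by mx4_entries; rewrite mx4E // /X_alpha /E !mxE !eq_inord4 //= ?(oppr0, addr0, add0r).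
Qed.

Lemma X_betaE : X_beta F = spm 0 1 0 0 0 0 0 0 0 0.
Proof.
by mx4_entries; rewrite mx4E // /X_beta /E !mxE !eq_inord4 //= ?(oppr0, addr0, add0r).
Qed.

Lemma X_alpha_betaE : X_alpha_beta F = spm 0 0 0 0 0 1 0 0 0 0.
Proof.
by mx4_entries; rewrite mx4E // /X_alpha_beta /E !mxE !eq_inord4 //= ?(oppr0, addr0, add0r).
Qed.

Lemma X_alpha_2betaE : X_alpha_2beta F = spm 0 0 0 0 1 0 0 0 0 0.
Proof.
by mx4_entries; rewrite mx4E // /X_alpha_2beta /E !mxE !eq_inord4 //= ?(oppr0, addr0, add0r).
Qed.

Lemma spm_inj a b c d x y z u v w a' b' c' d' x' y' z' u' v' w' :
  spm a b c d x y z u v w = spm a' b' c' d' x' y' z' u' v' w' ->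
  [/\ [/\ a = a', b = b', c = c' & d = d'], [/\ x = x', y = y' & z = z']
    & [/\ u = u', v = v' & w = w']].
Proof.
move=> /matrixP eqXY.
have e i j (li : (i < 4)%N) (lj : (j < 4)%N) := eqXY (inord i) (inord j).
have /= := (e 0 0 isT isT, e 0 1 isT isT, e 1 0 isT isT, e 1 1 isT isT, e 0 2 isT isT,
 e 0 3 isT isT, e 1 3 isT isT, e 2 0 isT isT, e 2 1 isT isT, e 3 1 isT isT)%N.
by rewrite !mx4E //= => -[[[[[[[[[]]]]]]]]].
Qed.

Lemma sp4P X : X \in sp4 ->
  exists a b c d x y z u v w, X = spm a b c d x y z u v w.
Proof.
rewrite inE [X]mx4_eta /= => /eqP/matrixP eqX.
have e i j (li : (i < 4)%N) (lj : (j < 4)%N) := eqX (inord i) (inord j).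
move: e; set M := mx4 _ => e.
exists (M (inord 0) (inord 0)), (M (inord 0) (inord 1)), (M (inord 1) (inord 0)),
  (M (inord 1) (inord 1)), (M (inord 0) (inord 2)), (M (inord 0) (inord 3)),
  (M (inord 1) (inord 3)), (M (inord 2) (inord 0)), (M (inord 2) (inord 1)),
  (M (inord 3) (inord 1)).
(* Ten entries are the chosen coordinates themselves; the other six are recovered from the defining
   equation. *)
mx4_entries; rewrite [RHS]mx4E //=; first
  [done | rewrite -[LHS]e // !(mulmx4, JE, mx4E, mxE) ?inordK //=; ring].
Qed.

(** Invertibility is automatic: the product is the unit [J], so each of its factors is a unit. *)
Lemma Sp4_mx4 (l : seq (seq F)) : mx4 l *m J F *m (mx4 l)^T = J F -> mx4 l \in Sp4.
Proof.
move=> eq; rewrite inE eq eqxx andbT.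
suff Ju: J F \in unitmx by move: Ju; rewrite -{1}eq !unitmx_mul => /andP[/andP[]].
apply: (@mulmx1_unit _ _ _ (- J F) _).1; rewrite JE; mx4_ring.
Qed.

End LieCoordinates.

(** * Conjugation by Sp(4) *)

Section Conjugation.
Variable F : fieldType.
Implicit Types (X Y Z g h : 'M[F]_4) (s t : {vspace 'M[F]_4}).

Lemma mulJJ : J F *m J F = - 1%:M.
Proof. by rewrite JE; mx4_ring. Qed.

(** Multiplying by [J], with [J] squared equal to -1, turns the definition into skew-adjointness for
    the symplectic form. *)
Lemma sp4E X : (X \in sp4) = (X *m J F == - (J F *m X^T)).
Proof.
rewrite inE; apply/eqP/eqP => [eqX|XJ].
  by rewrite -{1}eqX -mulmxA mulJJ mulmxN mulmx1.
by apply: (@oppr_inj _); rewrite -mulNmx -XJ -mulmxA mulJJ mulmxN mulmx1.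
Qed.

Lemma Sp4_unit g : g \in Sp4 -> g \in unitmx.
Proof. by case/andP. Qed.

Lemma Sp4_J g : g \in Sp4 -> g *m J F *m g^T = J F.
Proof. by case/andP => _ /eqP. Qed.

Lemma Sp4_1 : (1%:M : 'M[F]_4) \in Sp4.
Proof. by rewrite inE unitmx1 trmx1 mul1mx mulmx1 eqxx. Qed.

Lemma Sp4_mul g h : g \in Sp4 -> h \in Sp4 -> g *m h \in Sp4.
Proof.
move=> gS hS; rewrite inE unitmx_mul !Sp4_unit //= trmx_mul.
by rewrite !mulmxA -[g *m h *m _]mulmxA -[g *m _ *m h^T]mulmxA Sp4_J // Sp4_J.
Qed.

Lemma Sp4_inv g : g \in Sp4 -> invmx g \in Sp4.
Proof.
move=> gS; have gU := Sp4_unit gS.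
rewrite inE unitmx_inv gU /= -{1}(Sp4_J gS) !mulmxA mulVmx // mul1mx.
by rewrite -mulmxA -trmx_mul mulVmx // trmx1 mulmx1.
Qed.

Lemma conj_byE g X : conj_by g X = g *m X *m invmx g.
Proof. by rewrite lfunE. Qed.

(** Intertwining relations [g *m X = Y *m g] replace conjugation throughout, so that no explicit
    inverse has to be computed. *)
Lemma conj_by_eq g X Y : g \in unitmx -> g *m X = Y *m g -> conj_by g X = Y.
Proof. by move=> gU gX; rewrite conj_byE gX mulmxK. Qed.

Lemma conj_byM g h X : g \in unitmx -> h \in unitmx ->
  conj_by g (conj_by h X) = conj_by (g *m h) X.
Proof.
move=> gU hU; apply/esym/conj_by_eq; first by rewrite unitmx_mul gU.
by rewrite !conj_byE !mulmxA !mulmxKV.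
Qed.

Lemma conj_byK g : g \in unitmx -> cancel (conj_by g) (conj_by (invmx g)).
Proof.
by move=> gU X; rewrite conj_byM ?unitmx_inv // mulVmx // conj_byE mul1mx invmx1 mulmx1.
Qed.

Lemma img_conj_byM g h s : g \in unitmx -> h \in unitmx ->
  (conj_by g @: (conj_by h @: s) = conj_by (g *m h) @: s)%VS.
Proof.
move=> gU hU; rewrite -limg_comp; congr (_ @: _)%VS.
by apply/lfunP => X; rewrite comp_lfunE conj_byM.
Qed.

Lemma img_conj_by1 s : (conj_by 1%:M @: s = s)%VS.
Proof.
rewrite -[RHS](lim1g s); congr (_ @: _)%VS; apply/lfunP => X.
by rewrite conj_byE id_lfunE mul1mx invmx1 mulmx1.
Qed.

Lemma lker_conj_by g : g \in unitmx -> lker (conj_by g) == 0%VS.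
Proof. by move=> gU; apply/lker0P; apply: can_inj (conj_byK gU). Qed.

Lemma dim_img_conj_by g s : g \in unitmx -> \dim (conj_by g @: s) = \dim s.
Proof.
by move=> gU; rewrite limg_dim_eq // (eqP (lker_conj_by gU)) capv0.
Qed.

Lemma lie_conj_by g X Y : g \in unitmx ->
  lie (conj_by g X) (conj_by g Y) = conj_by g (lie X Y).
Proof.
move=> gU; rewrite /lie linearB /=; congr (_ - _);
  by rewrite !conj_byE !mulmxA mulmxKV.
Qed.

Lemma conj_by_sp4 g X : g \in Sp4 -> X \in sp4 -> conj_by g X \in sp4.
Proof.
move=> gS; have gU := Sp4_unit gS; rewrite !sp4E => /eqP XJ; rewrite conj_byE.
have gJ : invmx g *m J F = J F *m g^T by rewrite -{1}(Sp4_J gS) !mulmxA mulVmx // mul1mx.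
have Jg : J F *m (invmx g)^T = g *m J F.
  by rewrite -{1}(Sp4_J gS) -!mulmxA -trmx_mul mulVmx // trmx1 mulmx1.
rewrite -!mulmxA gJ (mulmxA X) XJ !trmx_mul !mulmxA Jg.
by rewrite mulmxN mulNmx !mulmxA.
Qed.

Lemma mem_img_conj_by g s X Y : g \in unitmx -> X \in s -> g *m X = Y *m g ->
  Y \in (conj_by g @: s)%VS.
Proof. by move=> gU Xs gX; rewrite -(conj_by_eq gU gX) memv_img. Qed.

Lemma sp4_equiv_trans s t r : sp4_equiv s t -> sp4_equiv t r -> sp4_equiv s r.
Proof.
move=> [g gS <-] [h hS <-]; exists (h *m g); first exact: Sp4_mul.
by rewrite img_conj_byM ?Sp4_unit.
Qed.

Lemma sp4_equiv_sym s t : sp4_equiv s t -> sp4_equiv t s.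
Proof.
move=> [g gS <-]; have gU := Sp4_unit gS; exists (invmx g); first exact: Sp4_inv.
by rewrite img_conj_byM ?unitmx_inv // mulVmx // img_conj_by1.
Qed.

Lemma conj_lie_subalgebra g s : g \in Sp4 ->
  lie_subalgebra s -> lie_subalgebra (conj_by g @: s)%VS.
Proof.
move=> gS [sub_s lie_s]; split=> [_ /memv_imgP[X Xs ->]|
  _ _ /memv_imgP[X Xs ->] /memv_imgP[Y Ys ->]].
  by rewrite conj_by_sp4 ?sub_s.
by rewrite lie_conj_by ?Sp4_unit // memv_img ?lie_s.
Qed.

Lemma lie_suml I (r : seq I) (f : I -> 'M[F]_4) Y :
  lie (\sum_(i <- r) f i) Y = \sum_(i <- r) lie (f i) Y.
Proof. by rewrite /lie mulmx_suml mulmx_sumr -sumrB. Qed.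

Lemma lie_sumr I (r : seq I) (f : I -> 'M[F]_4) X :
  lie X (\sum_(i <- r) f i) = \sum_(i <- r) lie X (f i).
Proof. by rewrite /lie mulmx_suml mulmx_sumr -sumrB. Qed.

Lemma lieZl k X Y : lie (k *: X) Y = k *: lie X Y.
Proof. by rewrite /lie -scalemxAl -scalemxAr scalerBr. Qed.

Lemma lieZr k X Y : lie X (k *: Y) = k *: lie X Y.
Proof. by rewrite /lie -scalemxAl -scalemxAr scalerBr. Qed.

Lemma mem_lie_derived s X Y : X \in s -> Y \in s -> lie X Y \in lie_derived s.
Proof.
move=> Xs Ys; rewrite (coord_vbasis Xs) (coord_vbasis Ys) lie_suml.
apply: memv_suml => i _; rewrite lie_sumr; apply: memv_suml => j _.
rewrite lieZl lieZr; do 2!apply: memvZ.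
by apply/memv_span/allpairs_f; rewrite mem_nth // size_tuple.
Qed.

(* With H = [X, Y], the triple 2H, X, 2Y satisfies the standard sl2 relations. *)
Definition no_sl2 s : Prop := {in s &, forall X Y,
  lie (lie X Y) X = X -> lie (lie X Y) Y = - Y -> X = 0}.

(** With H = [X, Y], the relations X = [H, X] and Y = - [H, Y] keep X, Y and H in every term of the
    derived series. *)
Lemma solvable_no_sl2 s : lie_subalgebra s -> lie_solvable s -> no_sl2 s.
Proof.
move=> [_ lie_s] [n sn0] X Y Xs Ys HX HY.
have [XN _ _] : [/\ X \in iter n (@lie_derived F) s, Y \in iter n (@lie_derived F) s
    & lie X Y \in iter n (@lie_derived F) s].
  elim: n {sn0} => [|n [Xn Yn Hn]] /=; first by split; rewrite ?lie_s.
  split; last exact: mem_lie_derived.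
    by rewrite -HX mem_lie_derived.
  by rewrite -[Y]opprK -HY memvN mem_lie_derived.
by apply/eqP; rewrite -memv0 -sn0.
Qed.
End Conjugation.

(** * Cartan subalgebras *)

Section Torus.
Variable F : fieldType.
Implicit Types (a b : F) (X Y Z g h : 'M[F]_4) (s t : {vspace 'M[F]_4}).

Lemma semisimpleP X :
  semisimple X <-> exists2 P, P \in unitmx & exists D, P *m X = diag_mx D *m P.
Proof.
split=> [[P PU /diagonalizable_forPex[D /(simmxP PU) PX]]|[P PU [D PX]]].
  by exists P => //; exists D.
by exists P => //; apply/diagonalizable_forPex; exists D; apply/simmxP.
Qed.

Lemma semisimple_conj_by g X : g \in unitmx -> semisimple X -> semisimple (conj_by g X).
Proof.
move=> gU /semisimpleP[P PU [D PX]]; apply/semisimpleP.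
exists (P *m invmx g); first by rewrite unitmx_mul PU unitmx_inv.
by exists D; rewrite conj_byE !mulmxA mulmxKV // PX.
Qed.

Lemma semisimple_T a b : semisimple (T a b).
Proof. exact: diagonalizable_diag. Qed.

Lemma mem_span1 e1 Y : (Y \in <<[:: e1]>>%VS) -> exists k1, Y = k1 *: e1.
Proof. by rewrite span_seq1 => /vlineP. Qed.

Lemma mem_span_cons e l Y : Y \in <<e :: l>>%VS ->
  exists k, exists2 Z, Z \in <<l>>%VS & Y = k *: e + Z.
Proof. by rewrite span_cons => /memv_addP[_ /vlineP[k ->] [Z Zl ->]]; exists k, Z. Qed.

Lemma notin_span_entry (i j : nat) X (l : seq 'M[F]_4) :
  all (fun Y : 'M[F]_4 => Y (inord i) (inord j) == 0) l ->
  X (inord i) (inord j) != 0 -> X \notin <<l>>%VS.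
Proof.
move=> l0; apply: contraNN => Xl; apply/eqP.
elim: l X Xl l0 => [|e l IHl] X; first by rewrite span_nil memv0 => /eqP->; rewrite mxE.
move=> /mem_span_cons[k [Z Zl ->]] /= /andP[/eqP e0 l0].
by rewrite !mxE e0 mulr0 add0r IHl.
Qed.

Lemma dim_T_span : \dim <<[:: T 1 0; T 0 1 : 'M[F]_4]>> = 2%N.
Proof.
apply/eqP; rewrite -[2%N]/(size [:: T 1 0; T 0 1 : 'M[F]_4]) -/(free _).
rewrite !free_cons nil_free andbT span_nil memv0.
rewrite (@notin_span_entry 0 0); rewrite ?TE /= ?mx4E ?oner_eq0 ?eqxx //.
by apply/eqP => /matrixP/(_ (inord 1) (inord 1))/eqP; rewrite mx4E // mxE oner_eq0.
Qed.

(* [T 1 0] and [T 0 1] span the diagonal Cartan subalgebra. *)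
Definition no_torus s : Prop :=
  forall g, g \in Sp4 -> T 1 0 \in (conj_by g @: s)%VS -> ~ T 0 1 \in (conj_by g @: s)%VS.

Lemma no_cartan_no_torus s :
  ~ (exists2 h, cartan_subalgebra h & (h <= s)%VS) -> no_torus s.
Proof.
move=> noC g gS T10 T01; apply: noC; have gU := Sp4_unit gS.
pose h0 := <<[:: T 1 0; T 0 1 : 'M[F]_4]>>%VS.
have h0P X : X \in h0 -> exists a b, X = T a b.
  move=> /mem_span_cons[a [_ /mem_span1[b ->] ->]]; exists a, b.
  by rewrite !TE !spmZ spmD !mulr0 !mulr1 !addr0 add0r.
have lie0 : {in h0 &, forall X Y, lie X Y = 0}.
  move=> _ _ /h0P[a [b ->]] /h0P[c [d ->]].
  by rewrite !TE lie_spm; mx4_ring.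
(* The Cartan subalgebra inside s is the diagonal one carried back by the inverse of g. *)
exists (conj_by (invmx g) @: h0)%VS.
  split.
  - apply: conj_lie_subalgebra; first exact: Sp4_inv.
    split=> [_ /h0P[a [b ->]]|X Y Xh Yh]; last by rewrite lie0 ?mem0v.
    by rewrite sp4E TE JE; apply/eqP; mx4_ring.
  - by rewrite dim_img_conj_by ?unitmx_inv // dim_T_span.
  - move=> _ _ /memv_imgP[X Xh ->] /memv_imgP[Y Yh ->].
    by rewrite lie_conj_by ?unitmx_inv // lie0 // linear0.
  - move=> _ /memv_imgP[_ /h0P[a [b ->]] ->].
    by apply: semisimple_conj_by (semisimple_T _ _); rewrite unitmx_inv.
suff: (conj_by (invmx g) @: h0 <= conj_by (invmx g) @: (conj_by g @: s))%VS.
  by rewrite img_conj_byM ?unitmx_inv // mulVmx // img_conj_by1.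
by apply: limgS; apply/span_subvP => X; rewrite !inE => /orP[] /eqP->.
Qed.

(** Solvability and the absence of Cartan subalgebras enter the case analysis through [no_sl2] and
    [no_torus]; all four conditions pass to conjugates, so s may be replaced at any stage. *)
Definition admissible s : Prop :=
  [/\ lie_subalgebra s, \dim s = 4%N, no_sl2 s & no_torus s].

Lemma admissible_conj_by g s : g \in Sp4 -> admissible s -> admissible (conj_by g @: s)%VS.
Proof.
move=> gS [ss ds sl2s ts]; have gU := Sp4_unit gS; split.
- exact: conj_lie_subalgebra.
- by rewrite dim_img_conj_by.
- move=> _ _ /memv_imgP[X Xs ->] /memv_imgP[Y Ys ->].
  have inj := can_inj (conj_byK gU).
  rewrite !lie_conj_by // => /inj HX; rewrite -linearN => /inj HY.
  by rewrite (sl2s X Y) // linear0.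
move=> h hS; rewrite img_conj_byM // ?Sp4_unit //.
by apply: ts; exact: Sp4_mul.
Qed.
End Torus.

(** * Diagonalization in Sp(4) *)

Section SymplecticForm.
Variable F : fieldType.
Implicit Types (a b k : F) (u v p : 'rV[F]_4) (X g : 'M[F]_4).

(** The symplectic form on row vectors: [g] is in [Sp4] exactly when its rows form a symplectic
    basis, and [g *m X = T a b *m g] says that these rows are left eigenvectors. *)
Definition omega u v : F := (u *m J F *m v^T) 0 0.

Lemma omegaE u v : omega u v =
  u 0 (inord 0) * v 0 (inord 2) + u 0 (inord 1) * v 0 (inord 3)
  - u 0 (inord 2) * v 0 (inord 0) - u 0 (inord 3) * v 0 (inord 1).
Proof.
rewrite /omega mxE sum_ord4 !mxE !sum_ord4 JE !mx4E //=; ring.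
Qed.

Lemma omegaN u v : omega u v = - omega v u.
Proof. rewrite !omegaE; ring. Qed.

Lemma omega_self u : omega u u = 0.
Proof. rewrite omegaE; ring. Qed.

Lemma omegaDl u v p : omega (u + v) p = omega u p + omega v p.
Proof. by rewrite /omega !mulmxDl mxE. Qed.

Lemma omegaZl k u v : omega (k *: u) v = k * omega u v.
Proof. by rewrite /omega -!scalemxAl mxE. Qed.

Lemma omegaZr k u v : omega u (k *: v) = k * omega u v.
Proof. by rewrite omegaN omegaZl [omega u v]omegaN mulrN. Qed.

Lemma omega_sp4 X u v : X \in sp4 -> omega (u *m X) v = - omega u (v *m X).
Proof.
rewrite sp4E => /eqP XJ.
by rewrite /omega -(mulmxA u) XJ mulmxN mulNmx mxE trmx_mul !mulmxA.
Qed.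

Lemma omega_eigen X u v a b : X \in sp4 -> u *m X = a *: u -> v *m X = b *: v ->
  omega u v != 0 -> b = - a.
Proof.
move=> Xsp uX vX uv0; have := omega_sp4 u v Xsp.
rewrite uX vX omegaZl omegaZr -mulNr => /(mulIf uv0) ->; exact/esym/opprK.
Qed.

(** Eigenvectors of a diagonalizable matrix span the whole space, so they cannot all lie in a proper
    subspace. *)
Lemma eigen_notin X m (W : 'M[F]_(m, 4)) : semisimple X -> (\rank W < 4)%N ->
  exists a, exists2 p : 'rV_4, p *m X = a *: p & ~~ (p <= W)%MS.
Proof.
move=> /semisimpleP[P PU [D PX]] rW.
have : ~~ (P <= W)%MS.
  by apply: contraL rW => /mxrankS; rewrite mxrank_unit // -leqNgt.
case/row_subPn => i Wi; exists (D 0 i), (row i P) => //.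
by rewrite -row_mul PX row_mul row_diag_mx -scalemxAl -rowE.
Qed.

(** By nondegeneracy the orthogonal of u, the kernel of [J F *m u^T], is a proper subspace, and some
    eigenvector avoids it. *)
Lemma eigen_omega X u : semisimple X -> u != 0 ->
  exists a, exists2 p, p *m X = a *: p & omega p u != 0.
Proof.
move=> ssX u0.
have c0 : J F *m u^T != 0.
  have [] := (@mulmx1_unit _ _ (J F) (- J F)); first by rewrite mulmxN mulJJ opprK.
  move=> JU _; apply: contraNneq u0 => Jc.
  by rewrite -[u]trmxK -[u^T](mulKmx JU) Jc mulmx0 trmx0.
have [|a [p pX]] := @eigen_notin X _ (kermx (J F *m u^T)) ssX.
  by rewrite mxrank_ker ltn_subrL lt0n mxrank_eq0 c0.
move=> /sub_kermxP/eqP/matrix0Pn[i [j]]; rewrite !ord1 mulmxA => pu.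
by exists a, p.
Qed.

Lemma hyperbolic_complement u v p a b X :
  X \in sp4 -> omega u v = 1 -> u *m X = a *: u -> v *m X = - a *: v ->
  p *m X = b *: p ->
  exists2 q, q *m X = b *: q &
    [/\ omega q u = 0, omega q v = 0 & p = q + omega p v *: u - omega p u *: v].
Proof.
move=> Xsp uv uX vX pX.
exists (p - omega p v *: u + omega p u *: v); last first.
  split; last by rewrite (addrAC (p - _)) subrK addrK.
  - by rewrite !omegaDl -scaleNr !omegaZl omega_self (omegaN v u) uv; ring.
  - by rewrite !omegaDl -scaleNr !omegaZl omega_self uv; ring.
(* Skew-adjointness makes [omega p v] vanish unless b = a, and [omega p u] unless b = - a; hence
   each subtracted term is zero or has eigenvalue b, and the projection stays an eigenvector. *)
have pv : b * omega p v = a * omega p v.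
  by rewrite -omegaZl -pX omega_sp4 // vX omegaZr mulNr opprK.
have pu : b * omega p u = - a * omega p u.
  by rewrite -omegaZl -pX omega_sp4 // uX omegaZr mulNr.
rewrite !mulmxDl mulNmx -!scalemxAl pX uX vX !scalerDr scalerN !scalerA.
by rewrite pv pu mulrC [- a * _]mulrC.
Qed.

Lemma semisimple_sp4_torus X : X \in sp4 -> semisimple X ->
  exists2 g, g \in Sp4 & exists a b, g *m X = T a b *m g.
Proof.
move=> Xsp ssX.
have [a [u uX]] := @eigen_notin X 4 0 ssX ltac:(by rewrite mxrank0).
rewrite submx0 => u0.
have [a' [v0 v0X v0u]] := eigen_omega ssX u0.
have uv0 : omega u v0 != 0 by rewrite omegaN oppr_eq0.
pose v := (omega u v0)^-1 *: v0.
have uv : omega u v = 1 by rewrite omegaZr mulVf.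
have vX : v *m X = - a *: v.
  rewrite -scalemxAl v0X (omega_eigen Xsp uX v0X uv0) !scalerA mulrC //.
clearbody v.
have [|b [p0 p0X p0W]] := @eigen_notin X _ (u + v)%MS ssX.
  apply: leq_ltn_trans (mxrank_adds_leqif _ _) _.
  by rewrite (leq_ltn_trans (leq_add (rank_leq_row _) (rank_leq_row _))).
have [p pX [pu pv p0E]] := hyperbolic_complement Xsp uv uX vX p0X.
have p_neq0 : p != 0.
  apply: contraNneq p0W => pe0; rewrite p0E pe0 add0r addmx_sub ?eqmx_opp //.
    by rewrite scalemx_sub ?addsmxSl.
  by rewrite scalemx_sub ?addsmxSr.
have [b' [q1 q1X q1p]] := eigen_omega ssX p_neq0.
have [q0 q0X [q0u q0v q1E]] := hyperbolic_complement Xsp uv uX vX q1X.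
(* Since p is orthogonal to u and v, removing the components of [q1] along them leaves its pairing
   with p unchanged. *)
have q0p : omega q0 p != 0.
  move: q1p; rewrite q1E !omegaDl -scaleNr !omegaZl (omegaN u) pu (omegaN v) pv.
  by rewrite oppr0 !mulr0 !addr0.
have pq0 : omega p q0 != 0 by rewrite omegaN oppr_eq0.
pose q := (omega p q0)^-1 *: q0.
have pq : omega p q = 1 by rewrite omegaZr mulVf.
have qX : q *m X = - b *: q.
  by rewrite -scalemxAl q0X (omega_eigen Xsp pX q0X pq0) !scalerA mulrC.
have qu : omega q u = 0 by rewrite omegaZl q0u mulr0.
have qv : omega q v = 0 by rewrite omegaZl q0v mulr0.
(* [J] pairs positions 0 with 2 and 1 with 3, hence the interleaved order, with eigenvalues a, b, -
   a, - b. *)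
pose r := [:: u; p; v; q].
pose g : 'M[F]_4 := \matrix_i r`_i.
have rg i : row i g = r`_i by rewrite rowK.
exists g.
  rewrite [g]mx4_eta; apply: Sp4_mx4; rewrite -mx4_eta.
  have gJ i j : (g *m J F *m g^T) i j = omega r`_i r`_j.
    rewrite /omega -!rg tr_row -row_mul mxE [RHS]mxE.
    by apply: eq_bigr => k _; rewrite [row _ _ _ _]mxE [col _ _ _ _]mxE.
  apply/matrixP => i j; rewrite gJ; elim/ord4P: i; elim/ord4P: j;
    rewrite JE mx4E // !inordK //= ?omega_self //;
    by rewrite ?(pu, pv, qu, qv, uv, pq) // omegaN ?(pu, pv, qu, qv, uv, pq) ?oppr0.
exists a, b; apply/row_matrixP => i; rewrite !row_mul rg row_diag_mx -scalemxAl -rowE rg mxE.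
by elim/ord4P: i; rewrite inordK.
Qed.

End SymplecticForm.

(** * Weyl group and embedded SL(2) *)

Ltac mx4_cases := move=> [|[|[|[|?]]]] [|[|[|[|?]]]] // _ _ /=.

(** Lets [ring] close a goal that is, up to sign, a rearrangement of a hypothesis. *)
Lemma eq_of_diff (R : zmodType) (x y x' y' : R) : x' = y' -> x - y = x' - y' -> x = y.
Proof. by move=> -> /eqP; rewrite subrr subr_eq0 => /eqP. Qed.

Ltac by_eq e := by first [apply: (eq_of_diff e); ring | apply: (eq_of_diff (esym e)); ring].

Section WeylGroup.
Variable F : fieldType.
Implicit Types (a b c d x y z u v w k p q r t : F) (X Y g : 'M[F]_4) (s : {vspace 'M[F]_4}).

(** On [T a b], the swap exchanges a and b (reflection in beta), and the flips negate a (reflection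
    in alpha + 2 beta) and b (reflection in alpha). The entries -1 make the representatives
    symplectic. *)
Definition weyl_swap : 'M[F]_4 :=
  mx4 [:: [:: 0; 1; 0; 0]; [:: 1; 0; 0; 0]; [:: 0; 0; 0; 1]; [:: 0; 0; 1; 0]].
Definition weyl_flip1 : 'M[F]_4 :=
  mx4 [:: [:: 0; 0; 1; 0]; [:: 0; 1; 0; 0]; [:: -1; 0; 0; 0]; [:: 0; 0; 0; 1]].
Definition weyl_flip2 : 'M[F]_4 :=
  mx4 [:: [:: 1; 0; 0; 0]; [:: 0; 0; 0; 1]; [:: 0; 0; 1; 0]; [:: 0; -1; 0; 0]].
(** For determinant 1, this is the SL(2) of the long root alpha, which centralizes [T 1 0];
    [short_sl2] is that of the short root beta, which centralizes [T 1 1]. *)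
Definition long_sl2 p q r t : 'M[F]_4 :=
  mx4 [:: [:: 1; 0; 0; 0]; [:: 0; p; 0; q]; [:: 0; 0; 1; 0]; [:: 0; r; 0; t]].
Definition short_sl2 p q r t : 'M[F]_4 :=
  mx4 [:: [:: p; q; 0; 0]; [:: r; t; 0; 0]; [:: 0; 0; t; - r]; [:: 0; 0; - q; p]].

(** The left side is [omega] of rows i and j, the right side the corresponding entry of [J]; both
    compute on literal indices. *)
Lemma Sp4_mx4_omega (l : seq (seq F)) :
  (forall i j, (i < 4)%N -> (j < 4)%N ->
    (nth [::] l i)`_0 * (nth [::] l j)`_2 + (nth [::] l i)`_1 * (nth [::] l j)`_3
    - (nth [::] l i)`_2 * (nth [::] l j)`_0 - (nth [::] l i)`_3 * (nth [::] l j)`_1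
    = (j == i + 2)%:R - (i == j + 2)%:R) -> mx4 l \in Sp4.
Proof.
move=> rowsP; apply: Sp4_mx4; apply/matrixP => i j.
rewrite -[LHS]/((mx4 l *m J F *m (mx4 l)^T) i j).
transitivity (omega (row i (mx4 l)) (row j (mx4 l))).
  rewrite /omega tr_row -row_mul mxE [RHS]mxE.
  by apply: eq_bigr => k _; rewrite [row _ _ _ _]mxE [col _ _ _ _]mxE.
rewrite omegaE JE !mxE !inordK // rowsP //; case: i j => -[|[|[|[|?]]]] // ? -[[|[|[|[|?]]]]] //= ?;
  by rewrite ?subr0 ?sub0r ?subrr.
Qed.

Lemma mx4_mul_eq (l m l' m' : seq (seq F)) :
  (forall i j, (i < 4)%N -> (j < 4)%N ->
    (nth [::] l i)`_0 * (nth [::] m 0)`_j + (nth [::] l i)`_1 * (nth [::] m 1)`_j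
    + (nth [::] l i)`_2 * (nth [::] m 2)`_j + (nth [::] l i)`_3 * (nth [::] m 3)`_j
    = (nth [::] l' i)`_0 * (nth [::] m' 0)`_j + (nth [::] l' i)`_1 * (nth [::] m' 1)`_j
    + (nth [::] l' i)`_2 * (nth [::] m' 2)`_j + (nth [::] l' i)`_3 * (nth [::] m' 3)`_j) ->
  mx4 l *m mx4 m = mx4 l' *m mx4 m'.
Proof. by move=> eqs; apply/matrixP => i j; rewrite !mulmx4 !mxE !inordK // eqs. Qed.

Lemma weyl_swap_Sp4 : weyl_swap \in Sp4.
Proof. by apply: Sp4_mx4_omega; mx4_cases; ring. Qed.

Lemma weyl_flip1_Sp4 : weyl_flip1 \in Sp4.
Proof. by apply: Sp4_mx4_omega; mx4_cases; ring. Qed.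

Lemma weyl_flip2_Sp4 : weyl_flip2 \in Sp4.
Proof. by apply: Sp4_mx4_omega; mx4_cases; ring. Qed.

Lemma J_Sp4 : J F \in Sp4.
Proof. by rewrite JE; apply: Sp4_mx4_omega; mx4_cases; ring. Qed.

Lemma long_sl2_Sp4 p q r t : p * t - q * r = 1 -> long_sl2 p q r t \in Sp4.
Proof.
by move=> det1; apply: Sp4_mx4_omega; mx4_cases; first [ring | rewrite -det1; ring].
Qed.

Lemma short_sl2_Sp4 p q r t : p * t - q * r = 1 -> short_sl2 p q r t \in Sp4.
Proof.
by move=> det1; apply: Sp4_mx4_omega; mx4_cases; first [ring | rewrite -det1; ring].
Qed.

Lemma weyl_swapE a b c d x y z u v w :
  weyl_swap *m spm a b c d x y z u v w = spm d c b a z y x w v u *m weyl_swap.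
Proof. by apply: mx4_mul_eq; mx4_cases; ring. Qed.

Lemma weyl_flip1E a b c d x y z u v w :
  weyl_flip1 *m spm a b c d x y z u v w =
  spm (- a) v y d (- u) (- c) z (- x) (- b) w *m weyl_flip1.
Proof. by apply: mx4_mul_eq; mx4_cases; ring. Qed.

Lemma weyl_flip2E a b c d x y z u v w :
  weyl_flip2 *m spm a b c d x y z u v w =
  spm a y v (- d) x (- b) (- w) u (- c) (- z) *m weyl_flip2.
Proof. by apply: mx4_mul_eq; mx4_cases; ring. Qed.

(** On sp(4), conjugation by [J] is X |-> - X^T, which exchanges every root with its opposite. *)
Lemma J_spmE a b c d x y z u v w :
  J F *m spm a b c d x y z u v w =
  spm (- a) (- c) (- b) (- d) (- u) (- v) (- w) (- x) (- y) (- z) *m J F.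
Proof. by rewrite JE; apply: mx4_mul_eq; mx4_cases; ring. Qed.

(** The hypotheses are the entries of the 2 x 2 relation g N = N' g with N = [[d, z], [w, - d]], so
    one computation in sl2 serves both embeddings. *)
Lemma long_sl2_row p q r t d z w d' z' w' :
  p * d + q * w = d' * p + z' * r -> p * z - q * d = d' * q + z' * t ->
  r * d + t * w = w' * p - d' * r -> r * z - t * d = w' * q - d' * t ->
  long_sl2 p q r t *m spm 0 0 0 d 0 0 z 0 0 w =
  spm 0 0 0 d' 0 0 z' 0 0 w' *m long_sl2 p q r t.
Proof.
by move=> e1 e2 e3 e4; apply: mx4_mul_eq; mx4_cases;
  first [ring | by_eq e1 | by_eq e2 | by_eq e3 | by_eq e4].
Qed.

(* The transpose-inverse block of a unimodular 2 x 2 block acts by the same equations. *)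
Lemma short_sl2_row p q r t d z w d' z' w' :
  p * d + q * w = d' * p + z' * r -> p * z - q * d = d' * q + z' * t ->
  r * d + t * w = w' * p - d' * r -> r * z - t * d = w' * q - d' * t ->
  short_sl2 p q r t *m spm d z w (- d) 0 0 0 0 0 0 =
  spm d' z' w' (- d') 0 0 0 0 0 0 *m short_sl2 p q r t.
Proof.
by move=> e1 e2 e3 e4; apply: mx4_mul_eq; mx4_cases;
  first [ring | by_eq e1 | by_eq e2 | by_eq e3 | by_eq e4].
Qed.

Lemma long_sl2_T10 p q r t : long_sl2 p q r t *m T 1 0 = T 1 0 *m long_sl2 p q r t.
Proof. by rewrite TE; apply: mx4_mul_eq; mx4_cases; ring. Qed.

Lemma short_sl2_T11 p q r t : short_sl2 p q r t *m T 1 1 = T 1 1 *m short_sl2 p q r t.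
Proof. by rewrite TE; apply: mx4_mul_eq; mx4_cases; ring. Qed.
End WeylGroup.

(** * Conjugacy of traceless 2 x 2 matrices, and eigenvalues of torus elements *)

Section ClosedField.
Variable F : numClosedFieldType.
Implicit Types (a b c d x y z u v w k p q r t : F) (X Y g : 'M[F]_4) (s : {vspace 'M[F]_4}).

Lemma sl2_diagonalize d z w : d ^+ 2 + z * w != 0 -> exists l p q r t,
  [/\ l != 0, p * t - q * r = 1 & [/\ p * d + q * w = l * p, p * z - q * d = l * q,
      r * d + t * w = - l * r & r * z - t * d = - l * t]].
Proof.
have [->|w0] := eqVneq w 0.
  rewrite mulr0 addr0 expf_eq0 /= => d0.
  by exists d, 1, (z / (2 * d)), 0, 1; split=> //; first ring; split; field; rewrite ?d0 ?pnatr_eq0.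
move=> D0; have [l l2] : exists l, l ^+ 2 = d ^+ 2 + z * w.
  by exists (sqrtC (d ^+ 2 + z * w)); rewrite sqrtCK.
have l0 : l != 0 by rewrite -sqrf_eq0 l2.
have zE : z = (l ^+ 2 - d ^+ 2) / w by rewrite l2; field.
(* The rows (w, l - d) and (w, - l - d) are left eigenvectors for l and - l; the second is scaled by
   - 1 / (2 l w) to make the determinant 1. *)
exists l, w, (l - d), (- (2 * l)^-1), ((l + d) / (2 * l * w)); rewrite zE; split=> //.
  by field; rewrite l0 w0.
by split; field; rewrite ?l0 ?w0.
Qed.

Lemma sl2_nilpotent d z w : d ^+ 2 + z * w = 0 -> [|| d != 0, z != 0 | w != 0] ->
  exists k p q r t,
  [/\ k != 0, p * t - q * r = 1 & [/\ p * d + q * w = k * r, p * z - q * d = k * t,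
      r * d + t * w = 0 & r * z - t * d = 0]].
Proof.
have [->|w0] := eqVneq w 0.
  rewrite mulr0 addr0 => /eqP; rewrite expf_eq0 /= => /eqP-> /=; rewrite eqxx orbF /= => z0.
  by exists z, 1, 0, 0, 1; split=> //; first ring; split; ring.
move=> dzw _; have zE : z = - d ^+ 2 / w.
  suff <- : z * w = - d ^+ 2 by rewrite mulfK.
  by apply/eqP; rewrite -addr_eq0 addrC dzw.
(* The second row (w, - d) spans the left kernel, and the first completes it to determinant 1. The
   factor k is kept, since only the line of the nilpotent matters. *)
exists (- w^-1), 0, (- w^-1), w, (- d); rewrite zE oppr_eq0 invr_eq0 w0; split=> //.
  by field.
by split; field.
Qed.

Lemma nonregular_T X g a b : g \in unitmx -> g *m X = T a b *m g -> semisimple X ->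
  ~ regular X -> [|| a == 0, b == 0, a == b | a == - b].
Proof.
move=> gU gX ssX; rewrite -[X in is_true X]negbK => nreg; apply/negP => H.
move: H nreg; rewrite !negb_or => /and4P[a0 b0 ab anb] [].
split=> //; exists [:: a; b; - a; - b]; split=> //.
  rewrite /= !inE !negb_or ab anb eqr_opp ab /=.
  have self c : c != 0 -> c != - c by move=> c0; rewrite -addr_eq0 -mulr2n mulrn_eq0.
  by rewrite !self //= eq_sym eqr_oppLR anb.
have ev (i : 'I_4) : eigenvalue X ([:: a; b; - a; - b]`_i).
  apply/eigenvalueP; exists (row i g).
    by rewrite -row_mul gX row_mul row_diag_mx -scalemxAl -rowE mxE.
  apply: contraTneq gU => gi; rewrite -row_free_unit; apply/row_freePn.
  by exists i; rewrite gi sub0mx.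
have := (ev (inord 0), ev (inord 1), ev (inord 2), ev (inord 3)).
by rewrite !inordK //= => -[[[-> ->] ->] ->].
Qed.
End ClosedField.

(** * Normal forms and gradings *)

Section NormalForms.
Variable F : fieldType.
Implicit Types (a b c d x y z u v w k : F) (X Y g : 'M[F]_4) (s t : {vspace 'M[F]_4}).

Lemma mem_span4 (e1 e2 e3 e4 : 'M[F]_4) Y :
  Y \in <<[:: e1; e2; e3; e4]>>%VS <->
  exists k1 k2 k3 k4, Y = k1 *: e1 + (k2 *: e2 + (k3 *: e3 + k4 *: e4)).
Proof.
split=> [|[k1 [k2 [k3 [k4 ->]]]]].
  move=> /mem_span_cons[k1 [_ /mem_span_cons[k2 [_
    /mem_span_cons[k3 [_ /mem_span1[k4 ->] ->]] ->]] ->]].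
  by exists k1, k2, k3, k4.
by rewrite !(memvD, memvZ) // memv_span // !inE eqxx ?orbT.
Qed.

Lemma T_n_pE a b :
  T_n_p a b = <<[:: T a b; X_alpha F; X_alpha_beta F; X_alpha_2beta F]>>%VS.
Proof. by rewrite span_cons. Qed.

Lemma mem_T_n_p a b Y :
  Y \in T_n_p a b <-> exists k x y z, Y = spm (k * a) 0 0 (k * b) x y z 0 0 0.
Proof.
have E k x y z : k *: T a b + (z *: X_alpha F + (y *: X_alpha_beta F + x *: X_alpha_2beta F))
    = spm (k * a) 0 0 (k * b) x y z 0 0 0.
  rewrite TE X_alphaE X_alpha_betaE X_alpha_2betaE !spmZ !spmD.
  by congr spm; ring.
rewrite T_n_pE mem_span4; split=> [[k [z [y [x ->]]]]|[k [x [y [z ->]]]]].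
  by exists k, x, y, z.
by exists k, z, y, x; rewrite E.
Qed.

Lemma mem_T_beta a b Y :
  Y \in T_beta a b <-> exists k m x y, Y = spm (k * a) m 0 (k * b) x y 0 0 0 0.
Proof.
have E k m x y : k *: T a b + (m *: X_beta F + (y *: X_alpha_beta F + x *: X_alpha_2beta F))
    = spm (k * a) m 0 (k * b) x y 0 0 0 0.
  rewrite TE X_betaE X_alpha_betaE X_alpha_2betaE !spmZ !spmD.
  by congr spm; ring.
rewrite mem_span4; split=> [[k [m [y [x ->]]]]|[k [m [x [y ->]]]]].
  by exists k, m, x, y.
by exists k, m, y, x; rewrite E.
Qed.

Lemma dim_T_n_p_le a b : (\dim (T_n_p a b) <= 4)%N.
Proof. by rewrite T_n_pE; apply: dim_span. Qed.

Lemma dim_T_beta_le a b : (\dim (T_beta a b) <= 4)%N.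
Proof. exact: dim_span. Qed.

(** Conjugation preserves dimension, so mapping s into t is enough, and a normal form only needs an
    upper bound on its dimension. *)
Lemma sp4_equiv_of_sub s t g : g \in Sp4 -> (\dim t <= \dim s)%N ->
  {in s, forall X, exists2 Y, Y \in t & g *m X = Y *m g} -> sp4_equiv s t.
Proof.
move=> gS dim_ts sub_st; have gU := Sp4_unit gS; exists g => //.
apply/eqP; rewrite eqEdim dim_img_conj_by // dim_ts andbT.
apply/subvP => _ /memv_imgP[X /sub_st[Y Yt gX] ->].
by rewrite (conj_by_eq gU gX).
Qed.

Lemma mem_eq s X Y : X \in s -> X = Y -> Y \in s.
Proof. by move=> + <-. Qed.

Lemma free_dim_le (l : seq 'M[F]_4) s : free l -> all (mem s) l -> (size l <= \dim s)%N.
Proof.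
move=> /eqP <- /allP sub_ls; apply/dimvS/span_subvP => X /sub_ls.
by [].
Qed.

Lemma sp4_subalgebraP s : lie_subalgebra s -> {in s, forall X,
  exists a b c d x y z u v w, X = spm a b c d x y z u v w}.
Proof. by move=> [ss _] X /ss/sp4P. Qed.

(* Each matrix has a nonzero entry at its position where all later ones vanish. *)
Fixpoint echelon (ps : seq (nat * nat)) (l : seq 'M[F]_4) : bool :=
  match l, ps with
  | [::], _ => true
  | X :: l', (i, j) :: ps' =>
    [&& X (inord i) (inord j) != 0,
        all (fun Y : 'M[F]_4 => Y (inord i) (inord j) == 0) l' & echelon ps' l']
  | _ :: _, [::] => false
  end.

Lemma echelon_free ps (l : seq 'M[F]_4) : echelon ps l -> free l.
Proof.
elim: l ps => [|X l IHl] [|[i j] ps] //= => [_|_|/and3P[X0 l0 /IHl lf]]; rewrite ?nil_free //.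
by rewrite free_cons lf (notin_span_entry l0 X0).
Qed.

Lemma dim4_no_echelon5 ps (l : seq 'M[F]_4) s : \dim s = 4%N -> size l = 5%N ->
  echelon ps l -> ~ all (mem s) l.
Proof. by move=> ds sl /echelon_free lf /(free_dim_le lf); rewrite ds sl. Qed.

End NormalForms.

(** * Projections onto the eigenspaces of ad S *)

Section Grading.
Variable F : numFieldType.
Implicit Types (a b c d x y z u v w k : F) (X Y g : 'M[F]_4) (s t : {vspace 'M[F]_4}).

Lemma T10_grading s a b c d x y z u v w : lie_subalgebra s -> T 1 0 \in s ->
  spm a b c d x y z u v w \in s ->
  [/\ [/\ spm 0 0 0 0 x 0 0 0 0 0 \in s, spm 0 b 0 0 0 y 0 0 0 0 \in s
        & spm 0 0 0 d 0 0 z 0 0 w \in s],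
      spm 0 0 c 0 0 0 0 0 v 0 \in s & spm 0 0 0 0 0 0 0 u 0 0 \in s].
Proof.
move=> [_ lie_s] Ss Xs; rewrite TE in Ss.
have adE a' b' c' d' x' y' z' u' v' w' :
    lie (spm 1 0 0 0 0 0 0 0 0 0) (spm a' b' c' d' x' y' z' u' v' w') =
    spm 0 b' (- c') 0 (x' *+ 2) y' 0 (- (u' *+ 2)) (- v') 0.
  by rewrite lie_spm; congr spm; ring.
have X1 := lie_s _ _ Ss Xs; have X2 := lie_s _ _ Ss X1.
have X3 := lie_s _ _ Ss X2; have X4 := lie_s _ _ Ss X3.
rewrite !adE in X1 X2 X3 X4.
(* Lagrange interpolation in ad S, whose eigenvalues are -2, ..., 2: (l^4 - l^2) / 24 + (l^3 - l) /
   12 is 1 at l = 2 and 0 at the others. *)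
have xs : spm 0 0 0 0 x 0 0 0 0 0 \in s.
  apply: mem_eq (memvD (memvZ (24%:R^-1) (memvD X4 (memvZ (-1) X2)))
    (memvZ (12%:R^-1) (memvD X3 (memvZ (-1) X1)))) _.
  by rewrite !(spmZ, spmD); congr spm; field.
have us : spm 0 0 0 0 0 0 0 u 0 0 \in s.
  apply: mem_eq (memvD (memvZ (24%:R^-1) (memvD X4 (memvZ (-1) X2)))
    (memvZ (- 12%:R^-1) (memvD X3 (memvZ (-1) X1)))) _.
  by rewrite !(spmZ, spmD); congr spm; field.
(* (l^2 + l) / 2 is 1 at l = 1 and 0 at l = -1, but 3 at l = 2 and 1 at l = -2; these two
   contributions are subtracted. *)
have bs : spm 0 b 0 0 0 y 0 0 0 0 \in s.
  apply: mem_eq (memvD (memvZ (2%:R^-1) (memvD X1 X2))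
    (memvD (memvZ (- 3%:R) xs) (memvZ (- 1) us))) _.
  by rewrite !(spmZ, spmD); congr spm; field.
have cs : spm 0 0 c 0 0 0 0 0 v 0 \in s.
  apply: mem_eq (memvD (memvZ (2%:R^-1) (memvD X2 (memvZ (-1) X1)))
    (memvD (memvZ (- 1) xs) (memvZ (- 3%:R) us))) _.
  by rewrite !(spmZ, spmD); congr spm; field.
split=> //; split=> //.
apply: mem_eq (memvD Xs (memvD (memvZ (- a) Ss)
  (memvZ (-1) (memvD (memvD xs us) (memvD bs cs))))) _.
by rewrite !(spmZ, spmD); congr spm; ring.
Qed.

Lemma T11_grading s a b c d x y z u v w : lie_subalgebra s -> T 1 1 \in s ->
  spm a b c d x y z u v w \in s ->
  [/\ spm 0 0 0 0 x y z 0 0 0 \in s, spm 0 0 0 0 0 0 0 u v w \in s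
    & spm ((a - d) / 2) b c (- ((a - d) / 2)) 0 0 0 0 0 0 \in s].
Proof.
move=> [_ lie_s] Ss Xs; rewrite TE in Ss.
have adE a' b' c' d' x' y' z' u' v' w' :
    lie (spm 1 0 0 1 0 0 0 0 0 0) (spm a' b' c' d' x' y' z' u' v' w') =
    spm 0 0 0 0 (x' *+ 2) (y' *+ 2) (z' *+ 2) (- (u' *+ 2)) (- (v' *+ 2)) (- (w' *+ 2)).
  by rewrite lie_spm; congr spm; ring.
have X1 := lie_s _ _ Ss Xs; have X2 := lie_s _ _ Ss X1.
rewrite !adE in X1 X2.
(* The eigenvalues are 0, 2 and -2, and l^2 / 8 + l / 4 is the interpolation polynomial at 2. *)
have Bs : spm 0 0 0 0 x y z 0 0 0 \in s.
  apply: mem_eq (memvD (memvZ (8%:R^-1) X2) (memvZ (4%:R^-1) X1)) _.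
  by rewrite !(spmZ, spmD); congr spm; field.
have Cs : spm 0 0 0 0 0 0 0 u v w \in s.
  apply: mem_eq (memvD (memvZ (8%:R^-1) X2) (memvZ (- 4%:R^-1) X1)) _.
  by rewrite !(spmZ, spmD); congr spm; field.
split=> //.
apply: mem_eq (memvD Xs (memvD (memvZ (- (a + d) / 2) Ss) (memvZ (-1) (memvD Bs Cs)))) _.
by rewrite !(spmZ, spmD); congr spm; field.
Qed.
End Grading.

(** * Case S = T 1 0 *)

Ltac mem_comb h :=
  apply: (mem_eq h); rewrite ?(TE, lie_spm, spmZ, spmD); congr spm; first [ring | by field].

Section LongRoot.
Variable F : numClosedFieldType.
Implicit Types (a b c d x y z u v w k : F) (X Y g : 'M[F]_4) (s t : {vspace 'M[F]_4}).

Lemma spm0 : 0 = spm 0 0 0 0 0 0 0 0 0 0 :> 'M[F]_4.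
Proof. mx4_ring. Qed.

Lemma dim4_not_in_span (l : seq 'M[F]_4) s : \dim s = 4%N -> (size l < 4)%N ->
  ~ {in s, forall X, X \in <<l>>%VS}.
Proof.
move=> ds sl /subvP/dimvS; rewrite ds leqNgt.
by rewrite (leq_ltn_trans (dim_span l)).
Qed.

Lemma no_sl2_long s x u : no_sl2 s ->
  spm 0 0 0 0 x 0 0 0 0 0 \in s -> spm 0 0 0 0 0 0 0 u 0 0 \in s -> x * u = 0.
Proof.
move=> sl2 xs us; apply/eqP/negPn/negP; rewrite mulf_eq0 negb_or => /andP[x0 u0].
(* This scaling makes the bracket equal to [T 2^-1 0], which acts on degrees 2 and -2 by 1 and
   -1. *)
have := sl2 _ _ xs (memvZ (2 * x * u)^-1 us); rewrite spmZ !lie_spm spm0 => /(_ _ _)/spm_inj.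
case=> [||_ [/eqP]]; rewrite ?(negPf x0) //.
  by congr spm; first [ring | by field; rewrite x0 u0].
by rewrite -scaleN1r spmZ; congr spm; first [ring | by field; rewrite x0 u0].
Qed.

Lemma T10_degree0_nilpotent s d z w : lie_subalgebra s -> no_torus s -> T 1 0 \in s ->
  spm 0 0 0 d 0 0 z 0 0 w \in s -> d ^+ 2 + z * w = 0.
Proof.
move=> ss ts Ss Ns; apply/eqP/negPn/negP => /sl2_diagonalize[l [p [q [r [t]]]]].
case=> l0 /long_sl2_Sp4 gS [e1 e2 e3 e4]; have gU := Sp4_unit gS.
apply: (ts _ gS); first exact: mem_img_conj_by gU Ss (long_sl2_T10 _ _ _ _).
have gN : long_sl2 p q r t *m spm 0 0 0 d 0 0 z 0 0 w = spm 0 0 0 l 0 0 0 0 0 0 *m long_sl2 p q r t.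
  by apply: long_sl2_row; rewrite ?e1 ?e2 ?e3 ?e4; ring.
by mem_comb (memvZ l^-1 (mem_img_conj_by gU Ns gN)).
Qed.

(** An element of degree -2 rules out degree 2 by [no_sl2_long], and degree 1 because the bracket
    would have the excluded degree -1; only two dimensions would remain. *)
Lemma T10_degree_pos s : lie_subalgebra s -> \dim s = 4%N -> no_sl2 s -> T 1 0 \in s ->
  (forall a b c d x y z u v w, spm a b c d x y z u v w \in s ->
     [/\ d = 0, z = 0, w = 0, c = 0 & v = 0]) ->
  sp4_equiv s (T_beta 1 0).
Proof.
move=> ss ds sl2 Ss sh; have lie_s := ss.2.
have sh_u a b c d x y z u v w : spm a b c d x y z u v w \in s -> u = 0.
  move=> Xs; apply/eqP/negPn/negP => u0.
  have [_ _ us] := T10_grading ss Ss Xs.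
  apply: (@dim4_not_in_span [:: T 1 0; spm 0 0 0 0 0 0 0 u 0 0] s ds isT) => Y Ys.
  have [a' [b' [c' [d' [x' [y' [z' [u' [v' [w' YE]]]]]]]]]] := sp4_subalgebraP ss Ys.
  rewrite {}YE in Ys *; have [-> -> -> -> ->] := sh _ _ _ _ _ _ _ _ _ _ Ys.
  have [[xs bs _] _ _] := T10_grading ss Ss Ys.
  have x'0 : x' = 0.
    by apply/eqP; move/eqP: (no_sl2_long sl2 xs us); rewrite mulf_eq0 (negPf u0) orbF.
  have := lie_s _ _ bs us; rewrite lie_spm => /sh[_ _ _ /eqP + /eqP].
  rewrite !(mul0r, mulr0, add0r, addr0, subr0, sub0r, oppr0, oppr_eq0, mulf_eq0) (negPf u0) !orbF.
  move=> /eqP -> /eqP ->; rewrite x'0.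
  have -> : spm a' 0 0 0 0 0 0 u' 0 0 = a' *: T 1 0 + (u' / u) *: spm 0 0 0 0 0 0 0 u 0 0.
    by rewrite TE !spmZ spmD; congr spm; first [ring | by field].
  by rewrite memvD // memvZ // memv_span // !inE eqxx ?orbT.
apply: (sp4_equiv_of_sub (@Sp4_1 F)); first by rewrite ds dim_T_beta_le.
move=> Y Ys; exists Y; last by rewrite mul1mx mulmx1.
have [a [b [c [d [x [y [z [u [v [w YE]]]]]]]]]] := sp4_subalgebraP ss Ys.
rewrite {}YE in Ys *; have [-> -> -> -> ->] := sh _ _ _ _ _ _ _ _ _ _ Ys.
rewrite (sh_u _ _ _ _ _ _ _ _ _ _ Ys); apply/mem_T_beta; exists a, b, x, y.
by rewrite mulr1 mulr0.
Qed.
End LongRoot.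

Lemma mulr2n_eq0 (F : numFieldType) (q : F) : q *+ 2 = 0 -> q = 0.
Proof. by move=> /eqP; rewrite mulrn_eq0 => /eqP. Qed.

Section LongRootCases.
Variable F : numClosedFieldType.
Implicit Types (a b c d x y z u v w k : F) (X Y g : 'M[F]_4) (s t : {vspace 'M[F]_4}).

Lemma sp4_equiv_img g s t : g \in Sp4 -> sp4_equiv (conj_by g @: s)%VS t -> sp4_equiv s t.
Proof. by move=> gS; apply: sp4_equiv_trans; exists g. Qed.

(** This Weyl element sends [T 1 0] to its negative and so reverses the grading. *)
Lemma mem_img_flip1 s a b c d x y z u v w : lie_subalgebra s ->
  spm a b c d x y z u v w \in (conj_by (weyl_flip1 F) @: s)%VS ->
  spm (- a) (- v) (- y) d (- u) c z (- x) b w \in s.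
Proof.
move=> ss /memv_imgP[X Xs XE].
have [a' [b' [c' [d' [x' [y' [z' [u' [v' [w' X'E]]]]]]]]]] := sp4_subalgebraP ss Xs.
move: XE Xs; rewrite {}X'E.
rewrite (conj_by_eq (Sp4_unit (weyl_flip1_Sp4 F)) (weyl_flip1E _ _ _ _ _ _ _ _ _ _)).
by move=> /spm_inj[[-> -> -> ->] [-> -> ->] [-> -> ->]]; rewrite !opprK.
Qed.

Lemma T10_img_flip1 s : T 1 0 \in s -> T 1 0 \in (conj_by (weyl_flip1 F) @: s)%VS.
Proof.
rewrite TE => Ss.
have := mem_img_conj_by (Sp4_unit (weyl_flip1_Sp4 F)) Ss
  (weyl_flip1E _ _ _ _ _ _ _ _ _ _).
by move=> /(memvZ (-1)) h; mem_comb h.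
Qed.

Lemma T10_degree0_trivial s : admissible s -> T 1 0 \in s ->
  (forall a b c d x y z u v w, spm a b c d x y z u v w \in s ->
     [/\ d = 0, z = 0 & w = 0]) ->
  sp4_equiv s (T_beta 1 0).
Proof.
move=> adm Ss sh; have [ss ds sl2 _] := adm; have lie_s := ss.2.
have [[a [b [c [d [x [y [z [u [v [w [Xs cv]]]]]]]]]]]|nX] := pselect (exists a b c d x y z u v w,
    spm a b c d x y z u v w \in s /\ (c != 0) || (v != 0)).
  have [[_ _ _] cs _] := T10_grading ss Ss Xs.
  have [ss' ds' sl2' _] := admissible_conj_by (weyl_flip1_Sp4 F) adm.
  apply: (sp4_equiv_img (weyl_flip1_Sp4 F)); apply: T10_degree_pos (T10_img_flip1 Ss) _ => //.
  move=> a' b' c' d' x' y' z' u' v' w' /(mem_img_flip1 ss) Ys.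
  have [-> -> ->] := sh _ _ _ _ _ _ _ _ _ _ Ys.
  have [[_ bs _] _ _] := T10_grading ss Ss Ys.
  (* The bracket of a degree 1 element (b, y) with the degree -1 element (c, v) lies in degree 0,
     where only multiples of S survive: y v = b c and c y = b v = 0. As (c, v) is nonzero, b = y =
     0. *)
  have := lie_s _ _ bs cs; rewrite lie_spm => /sh.
  rewrite !(mul0r, mulr0, add0r, addr0, subr0, sub0r, oppr0).
  case=> dE /mulr2n_eq0 + /mulr2n_eq0; move: dE => /eqP.
  rewrite !(mulrN, mulNr, opprK, oppr_eq0) => e1 /eqP e2 /eqP e3; move: e1 e2 e3.
  rewrite !(oppr_eq0, mulf_eq0); move: cv; have [->|c0] /= := eqVneq c 0.
    by move=> v0; rewrite mul0r add0r mulf_eq0 (negPf v0) !orbF => /eqP-> _ /eqP->.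
  move=> _ + /eqP c'0; rewrite c'0 mul0r addr0 mulf_eq0 (negPf c0) => /eqP->.
  by [].
apply: T10_degree_pos => // a b c d x y z u v w Xs; have [-> -> ->] := sh _ _ _ _ _ _ _ _ _ _ Xs.
suff /andP[/eqP-> /eqP->] : (c == 0) && (v == 0) by [].
apply/negPn/negP; rewrite negb_and => cv.
by apply: nX; exists a, b, c, d, x, y, z, u, v, w.
Qed.

(** Only the roots - beta, alpha, alpha + beta, alpha + 2 beta remain. If - beta occurs, alpha + 2
    beta cannot, since their bracket would add alpha + beta as a fifth dimension. The reflection in
    beta then gives the normal forms. *)
Lemma T10_alpha_no_lowest s :
  lie_subalgebra s -> \dim s = 4%N -> T 1 0 \in s -> spm 0 0 0 0 0 0 1 0 0 0 \in s ->
  (forall a b c d x y z u v w, spm a b c d x y z u v w \in s ->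
     [/\ b = 0, d = 0, w = 0, v = 0 & u = 0]) ->
  sp4_equiv s (T_n_p 0 1) \/ sp4_equiv s (T_beta 0 1).
Proof.
move=> ss ds Ss As sh; have lie_s := ss.2.
have [[a [b [c [d [x [y [z [u [v [w [Xs c0]]]]]]]]]]]|nX] := pselect (exists a b c d x y z u v w,
    spm a b c d x y z u v w \in s /\ (c != 0)).
  have [[_ _ _] cs _] := T10_grading ss Ss Xs.
  have [_ _ _ v0 _] := sh _ _ _ _ _ _ _ _ _ _ Xs; rewrite {}v0 in cs.
  have {}cs : spm 0 0 1 0 0 0 0 0 0 0 \in s by mem_comb (memvZ c^-1 cs).
  have shx a' b' c' d' x' y' z' u' v' w' : spm a' b' c' d' x' y' z' u' v' w' \in s -> x' = 0.
    move=> Ys; apply/eqP/negPn/negP => x0; have [[xs _ _] _ _] := T10_grading ss Ss Ys.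
    have {}xs : spm 0 0 0 0 1 0 0 0 0 0 \in s by mem_comb (memvZ x'^-1 xs).
    have ys : spm 0 0 0 0 0 1 0 0 0 0 \in s by mem_comb (lie_s _ _ cs xs).
    case: (@dim4_no_echelon5 _ [:: (0, 0); (1, 3); (1, 0); (0, 2); (0, 3)]%N
      [:: T 1 0; spm 0 0 0 0 0 0 1 0 0 0; spm 0 0 1 0 0 0 0 0 0 0;
          spm 0 0 0 0 1 0 0 0 0 0; spm 0 0 0 0 0 1 0 0 0 0] s ds erefl);
      last by rewrite /= Ss As cs xs ys.
    by rewrite TE /= !mx4E //= ?eqxx ?oner_eq0.
  right; apply: (sp4_equiv_of_sub (weyl_swap_Sp4 F)); first by rewrite ds dim_T_beta_le.
  move=> Y Ys.
  have [a' [b' [c' [d' [x' [y' [z' [u' [v' [w' YE]]]]]]]]]] := sp4_subalgebraP ss Ys.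
  rewrite {}YE in Ys *; have [-> -> -> -> ->] := sh _ _ _ _ _ _ _ _ _ _ Ys.
  rewrite (shx _ _ _ _ _ _ _ _ _ _ Ys).
  eexists; last exact: weyl_swapE.
  by apply/mem_T_beta; exists a', c', z', y'; rewrite mulr0 mulr1.
left; apply: (sp4_equiv_of_sub (weyl_swap_Sp4 F)); first by rewrite ds dim_T_n_p_le.
move=> Y Ys.
have [a' [b' [c' [d' [x' [y' [z' [u' [v' [w' YE]]]]]]]]]] := sp4_subalgebraP ss Ys.
rewrite {}YE in Ys *; have [-> -> -> -> ->] := sh _ _ _ _ _ _ _ _ _ _ Ys.
have -> : c' = 0.
  by apply/eqP/negPn/negP => c0; apply: nX; exists a', b', c', d', x', y', z', u', v', w'.
eexists; last exact: weyl_swapE.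
by apply/mem_T_n_p; exists a', z', y', x'; rewrite mulr0 mulr1.
Qed.

Lemma T10_alpha_classification s : admissible s -> T 1 0 \in s -> spm 0 0 0 0 0 0 1 0 0 0 \in s ->
  sp4_equiv s (T_n_p 0 1) \/ sp4_equiv s (T_beta 0 1).
Proof.
move=> adm Ss As; have [ss ds sl2 ts] := adm; have lie_s := ss.2.
have sh a b c d x y z u v w : spm a b c d x y z u v w \in s ->
    [/\ b = 0, d = 0, w = 0 & v = 0].
  move=> Xs; have [[_ bs Ns] cs _] := T10_grading ss Ss Xs.
  have dzw := T10_degree0_nilpotent ss ts Ss Ns.
  (* Both N and N + X_alpha are nilpotent; the two conditions differ by w, so w = 0 and then d =
     0. *)
  have NAs : spm 0 0 0 d 0 0 (z + 1) 0 0 w \in s by mem_comb (memvD Ns As).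
  have := T10_degree0_nilpotent ss ts Ss NAs.
  rewrite mulrDl mul1r addrA dzw add0r => w0; move: dzw; rewrite w0 mulr0 addr0.
  move=> /eqP; rewrite expf_eq0 /= => /eqP d0.
  split=> //; apply/eqP/negPn/negP => n0.
    (* X_alpha carries beta to alpha + beta, and these two bracket to alpha + 2 beta: five
       dimensions. A coordinate at - (alpha + beta) likewise generates - beta and - (alpha + 2
       beta). *)
    have ys : spm 0 0 0 0 0 1 0 0 0 0 \in s by mem_comb (memvZ (- b^-1) (lie_s _ _ As bs)).
    have {}bs : spm 0 1 0 0 0 0 0 0 0 0 \in s.
      by mem_comb (memvZ b^-1 (memvD bs (memvZ (- y) ys))).
    have xs : spm 0 0 0 0 1 0 0 0 0 0 \in s by mem_comb (memvZ 2^-1 (lie_s _ _ bs ys)).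
    case: (@dim4_no_echelon5 _ [:: (0, 0); (1, 3); (0, 1); (0, 2); (0, 3)]%N
      [:: T 1 0; spm 0 0 0 0 0 0 1 0 0 0; spm 0 1 0 0 0 0 0 0 0 0;
          spm 0 0 0 0 1 0 0 0 0 0; spm 0 0 0 0 0 1 0 0 0 0] s ds erefl);
      last by rewrite /= Ss As bs xs ys.
    by rewrite TE /= !mx4E //= ?eqxx ?oner_eq0.
  have {}c's : spm 0 0 1 0 0 0 0 0 0 0 \in s by mem_comb (memvZ v^-1 (lie_s _ _ As cs)).
  have vs : spm 0 0 0 0 0 0 0 0 1 0 \in s.
    by mem_comb (memvZ v^-1 (memvD cs (memvZ (- c) c's))).
  have us : spm 0 0 0 0 0 0 0 1 0 0 \in s by mem_comb (memvZ (- 2^-1) (lie_s _ _ c's vs)).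
  case: (@dim4_no_echelon5 _ [:: (0, 0); (1, 3); (1, 0); (2, 0); (2, 1)]%N
    [:: T 1 0; spm 0 0 0 0 0 0 1 0 0 0; spm 0 0 1 0 0 0 0 0 0 0;
        spm 0 0 0 0 0 0 0 1 0 0; spm 0 0 0 0 0 0 0 0 1 0] s ds erefl);
    last by rewrite /= Ss As c's us vs.
  by rewrite TE /= !mx4E //= ?eqxx ?oner_eq0.
have [[a [b [c [d [x [y [z [u [v [w [Xs u0]]]]]]]]]]]|nX] := pselect (exists a b c d x y z u v w,
    spm a b c d x y z u v w \in s /\ u != 0).
  have [_ _ us] := T10_grading ss Ss Xs.
  (* Degree -2 excludes degree 2, so after reversing the grading there is no degree -2 left; X_alpha
     is fixed. *)
  have gS := weyl_flip1_Sp4 F; have [ss' ds' _ _] := admissible_conj_by gS adm.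
  suff [?|?] : sp4_equiv (conj_by (weyl_flip1 F) @: s)%VS (T_n_p 0 1) \/
         sp4_equiv (conj_by (weyl_flip1 F) @: s)%VS (T_beta 0 1).
  - by left; apply: sp4_equiv_img gS _.
  - by right; apply: sp4_equiv_img gS _.
  apply: T10_alpha_no_lowest (T10_img_flip1 Ss) _ _ => //.
    have := mem_img_conj_by (Sp4_unit gS) As (weyl_flip1E _ _ _ _ _ _ _ _ _ _).
    by rewrite !oppr0.
  move=> a' b' c' d' x' y' z' u' v' w' /(mem_img_flip1 ss) Ys.
  have [[xs _ _] _ _] := T10_grading ss Ss Ys.
  have /eqP := no_sl2_long sl2 xs us; rewrite mulf_eq0 (negPf u0) orbF oppr_eq0 => /eqP ->.
  by have [/eqP + -> -> ->] := sh _ _ _ _ _ _ _ _ _ _ Ys; rewrite oppr_eq0 => /eqP->.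
apply: T10_alpha_no_lowest => // a b c d x y z u v w Xs.
have [-> -> -> ->] := sh _ _ _ _ _ _ _ _ _ _ Xs.
split=> //; apply/eqP/negPn/negP => u0.
by apply: nX; exists a, b, c, d, x, y, z, u, v, w.
Qed.

Lemma T10_classification s : admissible s -> T 1 0 \in s ->
  exists2 t, t \in normal_forms F & sp4_equiv s t.
Proof.
move=> adm Ss; have [ss ds sl2 ts] := adm.
have [[d [z [w [Ns dzw]]]]|nN] := pselect (exists d z w,
    spm 0 0 0 d 0 0 z 0 0 w \in s /\ [|| d != 0, z != 0 | w != 0]).
  have [k [p [q [r [t [k0 /long_sl2_Sp4 gS [e1 e2 e3 e4]]]]]]] :=
    sl2_nilpotent (T10_degree0_nilpotent ss ts Ss Ns) dzw.
  have gU := Sp4_unit gS.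
  have gN : long_sl2 p q r t *m spm 0 0 0 d 0 0 z 0 0 w =
      spm 0 0 0 0 0 0 k 0 0 0 *m long_sl2 p q r t.
    by apply: long_sl2_row; rewrite ?e1 ?e2 ?e3 ?e4; ring.
  have As : spm 0 0 0 0 0 0 1 0 0 0 \in (conj_by (long_sl2 p q r t) @: s)%VS.
    by mem_comb (memvZ k^-1 (mem_img_conj_by gU Ns gN)).
  have Ss' := mem_img_conj_by gU Ss (long_sl2_T10 _ _ _ _).
  have [eqt|eqt] := T10_alpha_classification (admissible_conj_by gS adm) Ss' As.
    by exists (T_n_p 0 1); [rewrite !inE eqxx | exact: sp4_equiv_img gS eqt].
  by exists (T_beta 0 1); [rewrite !inE eqxx ?orbT | exact: sp4_equiv_img gS eqt].
exists (T_beta 1 0); first by rewrite !inE eqxx ?orbT.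
apply: T10_degree0_trivial => // a b c d x y z u v w Xs.
have [[_ _ Ns] _ _] := T10_grading ss Ss Xs.
suff /and3P[/eqP-> /eqP-> /eqP->] : [&& d == 0, z == 0 & w == 0] by [].
by apply/negPn/negP; rewrite !negb_and => dzw; apply: nN; exists d, z, w.
Qed.
End LongRootCases.

(** * Case S = T 1 1 *)

Section ShortRootCases.
Variable F : numClosedFieldType.
Implicit Types (a b c d x y z u v w k : F) (X Y g : 'M[F]_4) (s t : {vspace 'M[F]_4}).

Lemma T11_degree0_nilpotent s d z w : lie_subalgebra s -> no_torus s -> T 1 1 \in s ->
  spm d z w (- d) 0 0 0 0 0 0 \in s -> d ^+ 2 + z * w = 0.
Proof.
move=> ss ts Ss Ns; apply/eqP/negPn/negP => /sl2_diagonalize[l [p [q [r [t]]]]].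
case=> l0 /short_sl2_Sp4 gS [e1 e2 e3 e4]; have gU := Sp4_unit gS.
have gN : short_sl2 p q r t *m spm d z w (- d) 0 0 0 0 0 0 =
    spm l 0 0 (- l) 0 0 0 0 0 0 *m short_sl2 p q r t.
  by apply: short_sl2_row; rewrite ?e1 ?e2 ?e3 ?e4; ring.
have Ss' := mem_img_conj_by gU Ss (short_sl2_T11 _ _ _ _).
have Ns' := memvZ l^-1 (mem_img_conj_by gU Ns gN).
rewrite TE in Ss'.
(* Half the sum and half the difference of [T 1 1] and [T 1 (- 1)] are the two generators of the
   diagonal torus. *)
apply: (ts _ gS).
  by mem_comb (memvZ 2^-1 (memvD Ss' Ns')).
by mem_comb (memvZ 2^-1 (memvD Ss' (memvZ (-1) Ns'))).
Qed.

(* A symmetric 2 x 2 matrix killing a nonzero vector r is a multiple of the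
   square of the vector orthogonal to r. *)
Lemma sym_kernel x y z p q : (p != 0) || (q != 0) ->
  x * p + y * q = 0 -> y * p + z * q = 0 ->
  exists k, [/\ x = k * q ^+ 2, y = - (k * p * q) & z = k * p ^+ 2].
Proof.
move=> + /eqP + /eqP; rewrite !addr_eq0 => /orP[n0|n0] /eqP e1 /eqP e2.
  exists (z / p ^+ 2).
  have yE : y = - (z * q) / p by rewrite -e2 mulfK.
  have xE : x = - (y * q) / p by rewrite -e1 mulfK.
  by rewrite xE yE; split; field.
exists (x / q ^+ 2).
have yE : y = - (x * p) / q by rewrite e1 opprK mulfK.
have zE : z = - (y * p) / q by rewrite e2 opprK mulfK.
by rewrite zE yE; split; field.
Qed.

(** For symmetric blocks B in degree 2 and C in degree -2, the bracket is given by B C, which must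
    be scalar; a nonzero scalar yields an sl2-triple, so B C = 0. If both degrees occur, all B share
    a kernel vector, as do all C, so each degree is a line and dim s <= 3. *)
Lemma T11_degree0_trivial s : admissible s -> T 1 1 \in s ->
  (forall a b c d x y z u v w, spm a b c d x y z u v w \in s ->
     [/\ a = d, b = 0 & c = 0]) ->
  sp4_equiv s (T_n_p 1 1).
Proof.
move=> adm Ss sh; have [ss ds sl2 _] := adm; have lie_s := ss.2.
have BC x y z u v w : spm 0 0 0 0 x y z 0 0 0 \in s -> spm 0 0 0 0 0 0 0 u v w \in s ->
    [/\ x * u + y * v = 0, x * v + y * w = 0, y * u + z * v = 0 & y * v + z * w = 0].
  move=> Bs Cs; have := lie_s _ _ Bs Cs; rewrite lie_spm => /sh.
  rewrite !(mul0r, mulr0, add0r, addr0, subr0, sub0r, oppr0) => -[e1 e2 e3].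
  suff H : x * u + y * v = 0 by rewrite -e1 H e2 e3.
  apply/eqP/negPn/negP => k0.
  (* The scaling makes the bracket S / 2, which acts on degrees 2 and -2 by 1 and -1. *)
  have HE : lie (spm 0 0 0 0 x y z 0 0 0) ((2 * (x * u + y * v))^-1 *: spm 0 0 0 0 0 0 0 u v w)
      = spm 2^-1 0 0 2^-1 0 0 0 0 0 0.
    rewrite spmZ lie_spm; congr spm; try by [ring | field].
    - by transitivity ((2 * (x * u + y * v))^-1 * (x * v + y * w)); [ring | rewrite e2 mulr0].
    - by transitivity ((2 * (x * u + y * v))^-1 * (y * u + z * v)); [ring | rewrite e3 mulr0].
    - transitivity ((2 * (x * u + y * v))^-1 * (y * v + z * w)); first by ring.
      by rewrite -e1; field.
  have := sl2 _ _ Bs (memvZ (2 * (x * u + y * v))^-1 Cs); rewrite HE spm0.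
  rewrite -scaleN1r !spmZ !lie_spm => /(_ _ _)/spm_inj; case=> [||_ [x0 y0 _] _].
  - by congr spm; first [ring | by field].
  - by congr spm; first [ring | by field].
  by move: k0; rewrite x0 y0 !mul0r addr0 eqxx.
have [[u [v [w [Cs uvw]]]]|nC] := pselect (exists u v w,
    spm 0 0 0 0 0 0 0 u v w \in s /\ [|| u != 0, v != 0 | w != 0]); last first.
  apply: (sp4_equiv_of_sub (@Sp4_1 F)); first by rewrite ds dim_T_n_p_le.
  move=> Y Ys; exists Y; last by rewrite mul1mx mulmx1.
  have [a [b [c [d [x [y [z [u [v [w YE]]]]]]]]]] := sp4_subalgebraP ss Ys.
  rewrite {}YE in Ys *; have [-> -> ->] := sh _ _ _ _ _ _ _ _ _ _ Ys.
  have [_ Cs _] := T11_grading ss Ss Ys.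
  suff /and3P[/eqP-> /eqP-> /eqP->] : [&& u == 0, v == 0 & w == 0].
    by apply/mem_T_n_p; exists d, x, y, z; rewrite mulr1.
  by apply/negPn/negP; rewrite !negb_and => uvw; apply: nC; exists u, v, w.
have [[x [y [z [Bs xyz]]]]|nB] := pselect (exists x y z,
    spm 0 0 0 0 x y z 0 0 0 \in s /\ [|| x != 0, y != 0 | z != 0]); last first.
  apply: (sp4_equiv_of_sub (J_Sp4 F)); first by rewrite ds dim_T_n_p_le.
  move=> Y Ys.
  have [a [b [c [d [x [y [z [u' [v' [w' YE]]]]]]]]]] := sp4_subalgebraP ss Ys.
  rewrite {}YE in Ys *; have [-> -> ->] := sh _ _ _ _ _ _ _ _ _ _ Ys.
  have [Bs _ _] := T11_grading ss Ss Ys.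
  suff /and3P[/eqP-> /eqP-> /eqP->] : [&& x == 0, y == 0 & z == 0].
    eexists; last exact: J_spmE; apply/mem_T_n_p.
    by exists (- d), (- u'), (- v'), (- w'); rewrite mulr1 !oppr0.
  by apply/negPn/negP; rewrite !negb_and => xyz; apply: nB; exists x, y, z.
(* A nonzero column of the fixed C is killed by every B, and below a nonzero column of the fixed B
   by every C. *)
have [p [q [pq0 Bpq]]] : exists p q, (p != 0) || (q != 0) /\
    (forall x y z, spm 0 0 0 0 x y z 0 0 0 \in s -> x * p + y * q = 0 /\ y * p + z * q = 0).
  have [uv0|] := boolP ((u != 0) || (v != 0)).
    by exists u, v; split=> // x' y' z' /BC/(_ Cs)[].
  rewrite negb_or !negbK => /andP[/eqP u0 /eqP v0]; move: uvw; rewrite u0 v0 eqxx /= => w0.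
  by exists v, w; split=> [|x' y' z' /BC/(_ Cs)[]]; rewrite ?w0 ?orbT.
have [p' [q' [pq0' Cpq]]] : exists p q, (p != 0) || (q != 0) /\
    (forall u v w, spm 0 0 0 0 0 0 0 u v w \in s -> u * p + v * q = 0 /\ v * p + w * q = 0).
  have [xy0|] := boolP ((x != 0) || (y != 0)).
    exists x, y; split=> // u' v' w' /(BC _ _ _ _ _ _ Bs)[e1 e2 _ _].
    by rewrite -[in RHS]e1 -e2; split; ring.
  rewrite negb_or !negbK => /andP[/eqP x0 /eqP y0]; move: xyz; rewrite x0 y0 eqxx /= => z0.
  exists y, z; split=> [|u' v' w' /(BC _ _ _ _ _ _ Bs)[_ _ e1 e2]]; first by rewrite z0 orbT.
  by split; [rewrite -[RHS]e1 | rewrite -[RHS]e2]; ring.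
case: (@dim4_not_in_span _ [:: T 1 1; spm 0 0 0 0 (q ^+ 2) (- (p * q)) (p ^+ 2) 0 0 0;
  spm 0 0 0 0 0 0 0 (q' ^+ 2) (- (p' * q')) (p' ^+ 2)] s ds isT) => Y Ys.
have [a [b [c [d [x' [y' [z' [u' [v' [w' YE]]]]]]]]]] := sp4_subalgebraP ss Ys.
rewrite {}YE in Ys *; have [-> -> ->] := sh _ _ _ _ _ _ _ _ _ _ Ys.
have [/Bpq[b1 b2] /Cpq[c1 c2] _] := T11_grading ss Ss Ys.
have [k [-> -> ->]] := sym_kernel pq0 b1 b2.
have [k' [-> -> ->]] := sym_kernel pq0' c1 c2.
set B := spm _ _ _ _ _ _ _ 0 0 0; set C := spm 0 0 0 0 0 0 0 _ _ _; set l := [:: _; _; _].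
have [Tl Bl Cl] : [/\ T 1 1 \in <<l>>%VS, B \in <<l>>%VS & C \in <<l>>%VS].
  by split; rewrite memv_span // !inE eqxx ?orbT.
by apply: mem_eq (memvD (memvZ d Tl) (memvD (memvZ k Bl) (memvZ k' Cl))) _;
  rewrite TE !spmZ !spmD; congr spm; ring.
Qed.

Lemma T11_beta_classification s : admissible s -> T 1 1 \in s -> spm 0 1 0 0 0 0 0 0 0 0 \in s ->
  sp4_equiv s (T_beta 1 1) \/ sp4_equiv s (T_n_p 1 (- 1)).
Proof.
move=> adm Ss bs; have [ss ds sl2 ts] := adm; have lie_s := ss.2.
have sh a b c d x y z u v w : spm a b c d x y z u v w \in s ->
    [/\ a = d, c = 0, z = 0 & u = 0].
  move=> Xs; have [Bs Cs Ns] := T11_grading ss Ss Xs.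
  have ebc := T11_degree0_nilpotent ss ts Ss Ns.
  have Nbs : spm ((a - d) / 2) (b + 1) c (- ((a - d) / 2)) 0 0 0 0 0 0 \in s.
    by mem_comb (memvD Ns bs).
  have := T11_degree0_nilpotent ss ts Ss Nbs.
  rewrite (mulrDl b) mul1r addrA ebc add0r => c0; move: ebc; rewrite c0 mulr0 addr0.
  move=> /eqP; rewrite expf_eq0 /= mulf_eq0 invr_eq0 pnatr_eq0 orbF subr_eq0 => /eqP ad.
  split=> //; apply/eqP/negPn/negP => n0.
    (* ad X_beta climbs the string alpha, alpha + beta, alpha + 2 beta, so a coordinate at its
       bottom generates all three. The opposite string behaves likewise below. *)
    have B1 := lie_s _ _ bs Bs; have B2 := lie_s _ _ bs B1.
    have xs : spm 0 0 0 0 1 0 0 0 0 0 \in s by mem_comb (memvZ (2 * z)^-1 B2).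
    have ys : spm 0 0 0 0 0 1 0 0 0 0 \in s.
      by mem_comb (memvZ z^-1 (memvD B1 (memvZ (- 2 * y) xs))).
    have zs : spm 0 0 0 0 0 0 1 0 0 0 \in s.
      by mem_comb (memvZ z^-1 (memvD Bs (memvD (memvZ (- x) xs) (memvZ (- y) ys)))).
    case: (@dim4_no_echelon5 _ [:: (0, 0); (0, 1); (0, 2); (0, 3); (1, 3)]%N
      [:: T 1 1; spm 0 1 0 0 0 0 0 0 0 0; spm 0 0 0 0 1 0 0 0 0 0;
          spm 0 0 0 0 0 1 0 0 0 0; spm 0 0 0 0 0 0 1 0 0 0] s ds erefl);
      last by rewrite /= Ss bs xs ys zs.
    by rewrite TE /= !mx4E //= ?eqxx ?oner_eq0.
  have C1 := lie_s _ _ bs Cs; have C2 := lie_s _ _ bs C1.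
  have ws : spm 0 0 0 0 0 0 0 0 0 1 \in s by mem_comb (memvZ (2 * u)^-1 C2).
  have vs : spm 0 0 0 0 0 0 0 0 1 0 \in s.
    by mem_comb (memvZ (- u^-1) (memvD C1 (memvZ (2 * v) ws))).
  have us : spm 0 0 0 0 0 0 0 1 0 0 \in s.
    by mem_comb (memvZ u^-1 (memvD Cs (memvD (memvZ (- v) vs) (memvZ (- w) ws)))).
  case: (@dim4_no_echelon5 _ [:: (0, 0); (0, 1); (2, 0); (2, 1); (3, 1)]%N
    [:: T 1 1; spm 0 1 0 0 0 0 0 0 0 0; spm 0 0 0 0 0 0 0 1 0 0;
        spm 0 0 0 0 0 0 0 0 1 0; spm 0 0 0 0 0 0 0 0 0 1] s ds erefl);
    last by rewrite /= Ss bs us vs ws.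
  by rewrite TE /= !mx4E //= ?eqxx ?oner_eq0.
have [[a [b [c [d [x [y [z [u [v [w [Xs y0]]]]]]]]]]]|ny] := pselect (exists a b c d x y z u v w,
    spm a b c d x y z u v w \in s /\ y != 0).
  have [Bs _ _] := T11_grading ss Ss Xs.
  have [_ _ z0 _] := sh _ _ _ _ _ _ _ _ _ _ Xs; rewrite {}z0 in Bs.
  have xs : spm 0 0 0 0 1 0 0 0 0 0 \in s by mem_comb (memvZ (2 * y)^-1 (lie_s _ _ bs Bs)).
  have ys : spm 0 0 0 0 0 1 0 0 0 0 \in s by mem_comb (memvZ y^-1 (memvD Bs (memvZ (- x) xs))).
  (* S, X_beta, X_alpha_beta and X_alpha_2beta already fill dimension 4, so any remaining negative
     coordinate would be a fifth dimension. *)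
  left; apply: (sp4_equiv_of_sub (@Sp4_1 F)); first by rewrite ds dim_T_beta_le.
  move=> Y Ys; exists Y; last by rewrite mul1mx mulmx1.
  have [a' [b' [c' [d' [x' [y' [z' [u' [v' [w' YE]]]]]]]]]] := sp4_subalgebraP ss Ys.
  rewrite {}YE in Ys *; have [-> -> -> u'0] := sh _ _ _ _ _ _ _ _ _ _ Ys.
  have [_ Cs _] := T11_grading ss Ss Ys; rewrite {}u'0 in Cs *.
  have v'0 : v' = 0.
    apply/eqP/negPn/negP => v'0.
    have ws : spm 0 0 0 0 0 0 0 0 0 1 \in s by mem_comb (memvZ (- (2 * v')^-1) (lie_s _ _ bs Cs)).
    have vs : spm 0 0 0 0 0 0 0 0 1 0 \in s by mem_comb (memvZ v'^-1 (memvD Cs (memvZ (- w') ws))).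
    case: (@dim4_no_echelon5 _ [:: (0, 0); (0, 1); (0, 2); (0, 3); (2, 1)]%N
      [:: T 1 1; spm 0 1 0 0 0 0 0 0 0 0; spm 0 0 0 0 1 0 0 0 0 0;
          spm 0 0 0 0 0 1 0 0 0 0; spm 0 0 0 0 0 0 0 0 1 0] s ds erefl);
      last by rewrite /= Ss bs xs ys vs.
    by rewrite TE /= !mx4E //= ?eqxx ?oner_eq0.
  have w'0 : w' = 0.
    apply/eqP/negPn/negP => w'0; rewrite v'0 in Cs.
    have ws : spm 0 0 0 0 0 0 0 0 0 1 \in s by mem_comb (memvZ w'^-1 Cs).
    case: (@dim4_no_echelon5 _ [:: (0, 0); (0, 1); (0, 2); (0, 3); (3, 1)]%N
      [:: T 1 1; spm 0 1 0 0 0 0 0 0 0 0; spm 0 0 0 0 1 0 0 0 0 0;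
          spm 0 0 0 0 0 1 0 0 0 0; spm 0 0 0 0 0 0 0 0 0 1] s ds erefl);
      last by rewrite /= Ss bs xs ys ws.
    by rewrite TE /= !mx4E //= ?eqxx ?oner_eq0.
  rewrite v'0 w'0; apply/mem_T_beta; exists d', b', x', y'.
  by rewrite mulr1.
have shy a b c d x y z u v w : spm a b c d x y z u v w \in s -> y = 0.
  by move=> Xs; apply/eqP/negPn/negP => y0; apply: ny; exists a, b, c, d, x, y, z, u, v, w.
have [[a [b [c [d [x [y [z [u [v [w [Xs v0]]]]]]]]]]]|nv] := pselect (exists a b c d x y z u v w,
    spm a b c d x y z u v w \in s /\ v != 0).
  have [_ Cs _] := T11_grading ss Ss Xs.
  have [_ _ _ u0] := sh _ _ _ _ _ _ _ _ _ _ Xs; rewrite {}u0 in Cs.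
  have ws : spm 0 0 0 0 0 0 0 0 0 1 \in s by mem_comb (memvZ (- (2 * v)^-1) (lie_s _ _ bs Cs)).
  have vs : spm 0 0 0 0 0 0 0 0 1 0 \in s by mem_comb (memvZ v^-1 (memvD Cs (memvZ (- w) ws))).
  (* The product keeps the line of X_beta and sends - (alpha + beta) and - alpha to alpha + beta and
     alpha + 2 beta. *)
  left; apply: (sp4_equiv_of_sub (Sp4_mul (weyl_swap_Sp4 F) (J_Sp4 F)));
    first by rewrite ds dim_T_beta_le.
  move=> Y Ys.
  have [a' [b' [c' [d' [x' [y' [z' [u' [v' [w' YE]]]]]]]]]] := sp4_subalgebraP ss Ys.
  rewrite {}YE in Ys *; have [-> -> z'0 ->] := sh _ _ _ _ _ _ _ _ _ _ Ys.
  have y'0 := shy _ _ _ _ _ _ _ _ _ _ Ys.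
  have [Bs _ _] := T11_grading ss Ss Ys; rewrite {}z'0 {}y'0 in Bs *.
  have -> : x' = 0.
    apply/eqP/negPn/negP => x'0.
    have xs : spm 0 0 0 0 1 0 0 0 0 0 \in s by mem_comb (memvZ x'^-1 Bs).
    case: (@dim4_no_echelon5 _ [:: (0, 0); (0, 1); (0, 2); (2, 1); (3, 1)]%N
      [:: T 1 1; spm 0 1 0 0 0 0 0 0 0 0; spm 0 0 0 0 1 0 0 0 0 0;
          spm 0 0 0 0 0 0 0 0 1 0; spm 0 0 0 0 0 0 0 0 0 1] s ds erefl);
      last by rewrite /= Ss bs xs vs ws.
    by rewrite TE /= !mx4E //= ?eqxx ?oner_eq0.
  eexists; last by rewrite -mulmxA J_spmE mulmxA weyl_swapE -mulmxA.
  rewrite !oppr0; apply/mem_T_beta; exists (- d'), (- b'), (- w'), (- v').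
  by rewrite mulr1.
(* What is left has roots beta, alpha + 2 beta and - alpha; the reflection in alpha sends them to
   the three roots of [n_p], and [T 1 1] to [T 1 (- 1)]. *)
right; apply: (sp4_equiv_of_sub (weyl_flip2_Sp4 F)); first by rewrite ds dim_T_n_p_le.
move=> Y Ys.
have [a' [b' [c' [d' [x' [y' [z' [u' [v' [w' YE]]]]]]]]]] := sp4_subalgebraP ss Ys.
rewrite {}YE in Ys *; have [-> -> -> ->] := sh _ _ _ _ _ _ _ _ _ _ Ys.
rewrite (shy _ _ _ _ _ _ _ _ _ _ Ys).
have -> : v' = 0.
  by apply/eqP/negPn/negP => v0; apply: nv; exists a', b', c', d', x', y', z', u', v', w'.
eexists; last exact: weyl_flip2E.
rewrite !oppr0; apply/mem_T_n_p; exists d', x', (- b'), (- w').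
by rewrite mulr1 mulrN mulr1.
Qed.

Lemma T11_classification s : admissible s -> T 1 1 \in s ->
  exists2 t, t \in normal_forms F & sp4_equiv s t.
Proof.
move=> adm Ss; have [ss ds sl2 ts] := adm.
have [[d [z [w [Ns dzw]]]]|nN] := pselect (exists d z w,
    spm d z w (- d) 0 0 0 0 0 0 \in s /\ [|| d != 0, z != 0 | w != 0]).
  have [k [p [q [r [t [k0 /short_sl2_Sp4 gS [e1 e2 e3 e4]]]]]]] :=
    sl2_nilpotent (T11_degree0_nilpotent ss ts Ss Ns) dzw.
  have gU := Sp4_unit gS.
  have gN : short_sl2 p q r t *m spm d z w (- d) 0 0 0 0 0 0 =
      spm 0 k 0 (- 0) 0 0 0 0 0 0 *m short_sl2 p q r t.
    by apply: short_sl2_row; rewrite ?e1 ?e2 ?e3 ?e4; ring.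
  have bs : spm 0 1 0 0 0 0 0 0 0 0 \in (conj_by (short_sl2 p q r t) @: s)%VS.
    by mem_comb (memvZ k^-1 (mem_img_conj_by gU Ns gN)).
  have Ss' := mem_img_conj_by gU Ss (short_sl2_T11 _ _ _ _).
  have [eqt|eqt] := T11_beta_classification (admissible_conj_by gS adm) Ss' bs.
    by exists (T_beta 1 1); [rewrite !inE eqxx ?orbT | exact: sp4_equiv_img gS eqt].
  by exists (T_n_p 1 (- 1)); [rewrite !inE eqxx ?orbT | exact: sp4_equiv_img gS eqt].
exists (T_n_p 1 1); first by rewrite !inE eqxx ?orbT.
apply: T11_degree0_trivial => // a b c d x y z u v w Xs.
have [_ _ Ns] := T11_grading ss Ss Xs.
suff /and3P[/eqP ad /eqP-> /eqP->] : [&& (a - d) / 2 == 0, b == 0 & c == 0].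
  split=> //; apply/eqP; rewrite -subr_eq0.
  by move/eqP: ad; rewrite mulf_eq0 invr_eq0 pnatr_eq0 orbF.
by apply/negPn/negP; rewrite !negb_and => dzw; apply: nN; exists ((a - d) / 2), b, c.
Qed.
End ShortRootCases.

(** * Classification and inequivalence *)

Section Classification.
Variable F : numClosedFieldType.
Implicit Types (a b c d x y z u v w k : F) (X Y g : 'M[F]_4) (s t : {vspace 'M[F]_4}).

Lemma torus_classification s a b : admissible s -> T a b \in s -> T a b != 0 ->
  [|| a == 0, b == 0, a == b | a == - b] ->
  exists2 t, t \in normal_forms F & sp4_equiv s t.
Proof.
move=> adm; rewrite TE => Ts T0.
have ab0 : a = 0 -> b = 0 -> False by move=> a0 b0; move: T0; rewrite a0 b0 -spm0 eqxx.
case/or4P => /eqP E; rewrite {}E in ab0 Ts.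
- have b0 : b != 0 by apply/eqP/ab0.
  have gS := weyl_swap_Sp4 F; have gU := Sp4_unit gS.
  have T10 : T 1 0 \in (conj_by (weyl_swap F) @: s)%VS.
    by mem_comb (memvZ b^-1 (mem_img_conj_by gU Ts (weyl_swapE _ _ _ _ _ _ _ _ _ _))).
  have [t tn st] := T10_classification (admissible_conj_by gS adm) T10.
  by exists t => //; apply: sp4_equiv_img gS st.
- have a0 : a != 0 by apply/eqP => /ab0; apply.
  by apply: T10_classification => //; mem_comb (memvZ a^-1 Ts).
- have b0 : b != 0 by apply/eqP => b0; apply: ab0.
  by apply: T11_classification => //; mem_comb (memvZ b^-1 Ts).
- have b0 : b != 0 by apply/eqP => b0; apply: ab0; rewrite b0 ?oppr0.
  have gS := weyl_flip2_Sp4 F; have gU := Sp4_unit gS.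
  have T11 : T 1 1 \in (conj_by (weyl_flip2 F) @: s)%VS.
    by mem_comb (memvZ (- b^-1) (mem_img_conj_by gU Ts (weyl_flip2E _ _ _ _ _ _ _ _ _ _))).
  have [t tn st] := T11_classification (admissible_conj_by gS adm) T11.
  by exists t => //; apply: sp4_equiv_img gS st.
Qed.

Lemma nonregular_classification s : lie_subalgebra s -> \dim s = 4%N -> lie_solvable s ->
  (exists X, [/\ X \in s, X != 0, semisimple X & ~ regular X]) ->
  ~ (exists2 h, cartan_subalgebra h & (h <= s)%VS) ->
  exists2 t, t \in normal_forms F & sp4_equiv s t.
Proof.
move=> ss ds sols [X [Xs X0 ssX nregX]] noC.
have adm : admissible s.
  by split=> //; [exact: solvable_no_sl2 | exact: no_cartan_no_torus].
have [g gS [a [b gX]]] := semisimple_sp4_torus (ss.1 _ Xs) ssX.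
have gU := Sp4_unit gS.
have Ts := mem_img_conj_by gU Xs gX.
have T0 : T a b != 0.
  apply: contraNneq X0 => T0.
  by rewrite -[X](mulKmx gU) gX T0 mul0mx mulmx0.
have [t tn st] := torus_classification (admissible_conj_by gS adm) Ts T0
  (nonregular_T gU gX ssX nregX).
by exists t => //; apply: sp4_equiv_img gS st.
Qed.

Lemma equiv_T_n_p_01_10 : sp4_equiv (T_n_p (0 : F) 1) (T_n_p 1 0).
Proof.
apply: (sp4_equiv_of_sub (weyl_swap_Sp4 F)).
  apply: leq_trans (dim_T_n_p_le _ _) _.
  rewrite T_n_pE; apply: eq_leq; apply/esym/eqP.
  apply: (@echelon_free _ [:: (1, 1); (1, 3); (0, 3); (0, 2)]%N).
  by rewrite TE X_alphaE X_alpha_betaE X_alpha_2betaE /= !mx4E //= ?eqxx ?oner_eq0.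
move=> _ /mem_T_n_p[k [x [y [z ->]]]]; eexists; last exact: weyl_swapE.
by apply/mem_T_n_p; exists k, z, y, x; rewrite !mulr1 !mulr0.
Qed.

(** The reflection in alpha fixes alpha + 2 beta and exchanges beta with alpha + beta. *)
Lemma equiv_T_beta_11 : sp4_equiv (T_beta (1 : F) 1) (T_beta 1 (- 1)).
Proof.
apply: (sp4_equiv_of_sub (weyl_flip2_Sp4 F)).
  apply: leq_trans (dim_T_beta_le _ _) _.
  apply: eq_leq; apply/esym/eqP.
  apply: (@echelon_free _ [:: (0, 0); (0, 1); (0, 3); (0, 2)]%N).
  by rewrite TE X_betaE X_alpha_betaE X_alpha_2betaE /= !mx4E //= ?eqxx ?oner_eq0.
move=> _ /mem_T_beta[k [m [x [y ->]]]]; eexists; last exact: weyl_flip2E.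
by apply/mem_T_beta; exists k, y, x, (- m); rewrite !mulr1 mulrN mulr1 !oppr0.
Qed.
End Classification.

(** * Conjugation invariants *)

Section Invariants.
Variable F : numClosedFieldType.
Implicit Types (a b c d x y z u v w k : F) (X Y Z g : 'M[F]_4) (s t : {vspace 'M[F]_4}).

(** The square is the matrix product, so this sees the embedding in 4 x 4 matrices and not only the
    abstract Lie algebra. *)
Definition has_involution s : Prop := exists2 X, X \in s & X *m X = 1%:M.

Definition has_center s : Prop :=
  exists Z, [/\ Z \in s, Z != 0 & {in s, forall X, lie X Z = 0}].

Definition has_noncommuting_nilpotents s : Prop :=
  exists X Y, [/\ X \in s, Y \in s, X *m X = 0, Y *m Y = 0 & lie X Y != 0].

Lemma conj_by_mulmx g X Y : g \in unitmx ->
  conj_by g X *m conj_by g Y = conj_by g (X *m Y).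
Proof. by move=> gU; rewrite !conj_byE !mulmxA mulmxKV. Qed.

Lemma has_involution_equiv s t : sp4_equiv s t -> has_involution s -> has_involution t.
Proof.
move=> [g /Sp4_unit gU <-] [X Xs X2]; exists (conj_by g X); first exact: memv_img.
by rewrite conj_by_mulmx // X2 conj_byE mulmx1 mulmxV.
Qed.

Lemma has_center_equiv s t : sp4_equiv s t -> has_center s -> has_center t.
Proof.
move=> [g /Sp4_unit gU <-] [Z [Zs Z0 Zc]]; exists (conj_by g Z); split.
- exact: memv_img.
- by apply: contraNneq Z0 => /(canRL (conj_byK gU)); rewrite linear0 => ->.
- by move=> _ /memv_imgP[X Xs ->]; rewrite lie_conj_by // Zc // linear0.
Qed.

Lemma has_noncommuting_nilpotents_equiv s t : sp4_equiv s t ->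
  has_noncommuting_nilpotents s -> has_noncommuting_nilpotents t.
Proof.
move=> [g /Sp4_unit gU <-] [X [Y [Xs Ys X2 Y2 XY]]].
exists (conj_by g X), (conj_by g Y); split; rewrite ?memv_img //.
- by rewrite conj_by_mulmx // X2 linear0.
- by rewrite conj_by_mulmx // Y2 linear0.
- by rewrite lie_conj_by //; apply: contraNneq XY => /(canRL (conj_byK gU)); rewrite linear0 => ->.
Qed.

Lemma spm_sqr_entries a b d x y z : let X := spm a b 0 d x y z 0 0 0 in
  (X *m X) (inord 0) (inord 0) = a ^+ 2 /\ (X *m X) (inord 1) (inord 1) = d ^+ 2.
Proof. by split; rewrite !mulmx4 !mx4E //=; ring. Qed.

Lemma spm_involution a b d x y z : let X := spm a b 0 d x y z 0 0 0 in
  X *m X = 1%:M -> (a != 0) && (d != 0).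
Proof.
move=> X X2; have [] := spm_sqr_entries a b d x y z; rewrite -/X X2 !mxE !eqxx /=.
have nz (q : F) : 1 = q ^+ 2 -> q != 0.
  by move=> e; rewrite -sqrf_eq0 -e oner_eq0.
by move=> /nz -> /nz ->.
Qed.

Lemma T_n_p_involution a b : has_involution (T_n_p a b) -> (a != 0) && (b != 0).
Proof.
move=> [_ /mem_T_n_p[k [x [y [z ->]]]] /spm_involution].
by rewrite !mulf_eq0 !negb_or => /andP[/andP[_ ->] /andP[_ ->]].
Qed.

Lemma T_beta_involution a b : has_involution (T_beta a b) -> (a != 0) && (b != 0).
Proof.
move=> [_ /mem_T_beta[k [m [x [y ->]]]] /spm_involution].
by rewrite !mulf_eq0 !negb_or => /andP[/andP[_ ->] /andP[_ ->]].
Qed.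

Lemma T_involution b s : b ^+ 2 = 1 -> T 1 b \in s -> has_involution s.
Proof.
move=> b2 Ts; exists (T 1 b) => //; rewrite TE.
mx4_entries; rewrite !(mulmx4, mx4E, mxE) ?eq_inord4 //=; first [ring | by rewrite -b2; ring].
Qed.

Lemma mem_T_T_n_p a b : T a b \in T_n_p a b.
Proof. by rewrite T_n_pE memv_span // inE eqxx. Qed.

Lemma mem_T_T_beta a b : T a b \in T_beta a b.
Proof. by rewrite memv_span // inE eqxx. Qed.

(** A square-zero element has no torus part, hence lies in the abelian algebra [n_p]. *)
Lemma T_n_p_no_noncommuting_nilpotents a b : (a != 0) || (b != 0) ->
  ~ has_noncommuting_nilpotents (T_n_p a b).
Proof.
move=> ab0 [_ [_ [/mem_T_n_p[k [x [y [z ->]]]] /mem_T_n_p[k' [x' [y' [z' ->]]]] X2 Y2]]].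
have kE l p q r :
      spm (l * a) 0 0 (l * b) p q r 0 0 0 *m spm (l * a) 0 0 (l * b) p q r 0 0 0 = 0 -> l = 0.
  move=> Z2; have [] := spm_sqr_entries (l * a) 0 (l * b) p q r.
  rewrite Z2 !mxE => /esym/eqP + /esym/eqP; rewrite !expf_eq0 !mulf_eq0 /=.
  case/orP: ab0 => /negPf ->; rewrite orbF; first by move=> /eqP.
  by move=> _ /eqP.
rewrite lie_spm (kE _ _ _ _ X2) (kE _ _ _ _ Y2) => /eqP; apply.
by rewrite spm0; congr spm; ring.
Qed.

Lemma T_beta_noncommuting_nilpotents a b : has_noncommuting_nilpotents (T_beta a b).
Proof.
exists (spm 0 1 0 0 0 0 0 0 0 0), (spm 0 0 0 0 0 1 0 0 0 0); split.
- by apply/mem_T_beta; exists 0, 1, 0, 0; rewrite !mul0r.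
- by apply/mem_T_beta; exists 0, 0, 0, 1; rewrite !mul0r.
- mx4_ring.
- mx4_ring.
rewrite lie_spm spm0; apply/eqP => /spm_inj[_ [+ _ _] _] => /eqP.
by rewrite !(mul0r, mulr0, mul1r, add0r, subr0) pnatr_eq0.
Qed.

(** [T a b] acts on alpha + 2 beta, alpha + beta and alpha by 2a, a + b and 2b; a vanishing weight
    provides the central root vector here and for [T_n_p 1 (- 1)]. *)
Lemma T_n_p_01_center : has_center (T_n_p (0 : F) 1).
Proof.
exists (spm 0 0 0 0 1 0 0 0 0 0); split.
- by apply/mem_T_n_p; exists 0, 1, 0, 0; rewrite !mul0r.
- by apply/eqP; rewrite spm0 => /spm_inj[_ [/eqP]]; rewrite oner_eq0.
- by move=> _ /mem_T_n_p[k [x [y [z ->]]]]; rewrite lie_spm spm0; congr spm; ring.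
Qed.

Lemma T_beta_01_center : has_center (T_beta (0 : F) 1).
Proof.
exists (spm 0 0 0 0 1 0 0 0 0 0); split.
- by apply/mem_T_beta; exists 0, 0, 1, 0; rewrite !mul0r.
- by apply/eqP; rewrite spm0 => /spm_inj[_ [/eqP]]; rewrite oner_eq0.
- by move=> _ /mem_T_beta[k [m [x [y ->]]]]; rewrite lie_spm spm0; congr spm; ring.
Qed.

Lemma T_n_p_1N1_center : has_center (T_n_p (1 : F) (- 1)).
Proof.
exists (spm 0 0 0 0 0 1 0 0 0 0); split.
- by apply/mem_T_n_p; exists 0, 0, 1, 0; rewrite !mul0r.
- by apply/eqP; rewrite spm0 => /spm_inj[_ [_ /eqP]]; rewrite oner_eq0.
- by move=> _ /mem_T_n_p[k [x [y [z ->]]]]; rewrite lie_spm spm0; congr spm; ring.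
Qed.

Lemma T_n_p_11_centerless : ~ has_center (T_n_p (1 : F) 1).
Proof.
move=> [_ [/mem_T_n_p[k [x [y [z ->]]]] + Zc]].
have Xs : spm 0 0 0 0 1 0 0 0 0 0 \in T_n_p (1 : F) 1.
  by apply/mem_T_n_p; exists 0, 1, 0, 0; rewrite !mul0r.
have := Zc _ (mem_T_T_n_p 1 1); have := Zc _ Xs; rewrite TE !lie_spm !spm0.
rewrite !(mul0r, mulr0, mul1r, mulr1, add0r, addr0, subr0, sub0r, oppr0).
move=> /spm_inj[_ [/mulr2n_eq0/eqP k0 _ _] _] /spm_inj[_ [/mulr2n_eq0-> + /mulr2n_eq0->] _].
rewrite -mulr2n => /mulr2n_eq0 ->; move: k0; rewrite oppr_eq0 => /eqP ->.
by rewrite eqxx.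
Qed.

Lemma T_beta_1_centerless b : b = 0 \/ b = 1 -> ~ has_center (T_beta (1 : F) b).
Proof.
move=> b01 [_ [/mem_T_beta[k [m [x [y ->]]]] + Zc]].
have Xs : spm 0 0 0 0 1 0 0 0 0 0 \in T_beta (1 : F) b.
  by apply/mem_T_beta; exists 0, 0, 1, 0; rewrite !mul0r.
have Ys : spm 0 0 0 0 0 1 0 0 0 0 \in T_beta (1 : F) b.
  by apply/mem_T_beta; exists 0, 0, 0, 1; rewrite !mul0r.
(* X_alpha_beta detects the beta coordinate and X_alpha_2beta the torus coordinate; the torus acts
   on the other two by the nonzero weights 1 + b and 2. *)
have := Zc _ (mem_T_T_beta 1 b); have := Zc _ Xs; have := Zc _ Ys; rewrite TE !lie_spm !spm0.
rewrite !(mul0r, mulr0, mul1r, mulr1, add0r, addr0, subr0, sub0r, oppr0).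
move=> /spm_inj[_ [/mulr2n_eq0/eqP + _ _] _] /spm_inj[_ [/mulr2n_eq0/eqP + _ _] _].
rewrite !oppr_eq0 => /eqP-> /eqP->; rewrite mul0r.
move=> /spm_inj[_ [/mulr2n_eq0-> + _] _].
case: b01 => ->; first by rewrite mul0r addr0 => ->; rewrite eqxx.
by rewrite mul1r -mulr2n => /mulr2n_eq0 ->; rewrite eqxx.
Qed.

(** Involutions separate the first three forms from the last three. In each half the center isolates
    one form, [T_beta 1 0] (no center) or [T_n_p 1 (- 1)] (center), and noncommuting nilpotents
    separate the other two. *)
Lemma normal_forms_inequiv i j : (i < j < 6)%N ->
  ~ sp4_equiv (nth 0%VS (normal_forms F) i) (nth 0%VS (normal_forms F) j).
Proof.
have inv_np1 b : b ^+ 2 = 1 -> has_involution (T_n_p 1 b).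
  by move=> b2; apply: T_involution b2 (mem_T_T_n_p _ _).
have inv_b11 : has_involution (T_beta (1 : F) 1).
  by apply: (@T_involution 1); [rewrite expr1n | exact: mem_T_T_beta].
have inv0 : [/\ ~ has_involution (T_n_p (0 : F) 1), ~ has_involution (T_beta (0 : F) 1)
    & ~ has_involution (T_beta (1 : F) 0)].
  by split=> [/T_n_p_involution|/T_beta_involution|/T_beta_involution]; rewrite eqxx ?andbF.
have [inv_np01 inv_b01 inv_b10] := inv0.
have sN1 : (- 1) ^+ 2 = 1 :> F by rewrite sqrrN expr1n.
have s1 : 1 ^+ 2 = 1 :> F by rewrite expr1n.
have inv3 s t : ~ has_involution s -> has_involution t -> ~ sp4_equiv s t.
  by move=> ns ht /sp4_equiv_sym/has_involution_equiv/(_ ht).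
have nil_np a b : (a != 0) || (b != 0) -> ~ sp4_equiv (T_n_p a b) (T_beta (1 : F) 1)
    /\ ~ sp4_equiv (T_n_p a b) (T_beta (0 : F) 1).
  move=> /T_n_p_no_noncommuting_nilpotents no.
  by split=> /sp4_equiv_sym/has_noncommuting_nilpotents_equiv
    /(_ (T_beta_noncommuting_nilpotents _ _)).
have cent s t : has_center s -> ~ has_center t -> ~ sp4_equiv s t /\ ~ sp4_equiv t s.
  by move=> hs nt; split=> [|/sp4_equiv_sym] /has_center_equiv/(_ hs).
have c10 := @T_beta_1_centerless 0 (or_introl erefl).
have c11 := @T_beta_1_centerless 1 (or_intror erefl).
have n1 : (1 : F) != 0 by exact: oner_neq0.
move=> /andP[]; case: i j => [|[|[|[|[|i]]]]] [|[|[|[|[|[|j]]]]]] //= _ _.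
- by apply: (nil_np _ _ _).2; rewrite n1 orbT.
- exact: (cent _ _ T_n_p_01_center c10).1.
- exact: inv3 inv_np01 (inv_np1 _ s1).
- exact: inv3 inv_np01 (inv_np1 _ sN1).
- exact: inv3 inv_np01 inv_b11.
- exact: (cent _ _ T_beta_01_center c10).1.
- exact: inv3 inv_b01 (inv_np1 _ s1).
- exact: inv3 inv_b01 (inv_np1 _ sN1).
- exact: inv3 inv_b01 inv_b11.
- exact: inv3 inv_b10 (inv_np1 _ s1).
- exact: inv3 inv_b10 (inv_np1 _ sN1).
- exact: inv3 inv_b10 inv_b11.
- exact: (cent _ _ T_n_p_1N1_center T_n_p_11_centerless).2.
- by apply: (nil_np _ _ _).1; rewrite n1.
- exact: (cent _ _ T_n_p_1N1_center c11).1.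
Qed.
End Invariants.

Theorem theorem8p4 (R : realType) :
  [/\ forall s : {vspace 'M[R[i]]_4},
        lie_subalgebra s -> \dim s = 4%N -> lie_solvable s ->
        (exists X, [/\ X \in s, X != 0, semisimple X & ~ regular X]) ->
        ~ (exists2 h, cartan_subalgebra h & (h <= s)%VS) ->
        exists2 t, t \in normal_forms R[i] & sp4_equiv s t,
      sp4_equiv (T_n_p (0 : R[i]) 1) (T_n_p 1 0),
      sp4_equiv (T_beta (1 : R[i]) 1) (T_beta 1 (- 1))
    & forall i j : nat, (i < j < 6)%N ->
        ~ sp4_equiv (nth 0%VS (normal_forms R[i]) i)
                    (nth 0%VS (normal_forms R[i]) j)].
Proof.
split.
- exact: nonregular_classification.
- exact: equiv_T_n_p_01_10.
- exact: equiv_T_beta_11.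
- exact: normal_forms_inequiv.
Qed.
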